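(* Let $\Delta$ be a countably infinite structure with a finite relational signature which is ordered, homogeneous, Ramsey, and finitely bounded. Then for every reduct $\Gamma$ of $\Delta$ with finite relational signature, the computational problem $\operatorname{Expr}_{\operatorname{pp}}(\Gamma)$ is decidable.
   Context: Substructures are always induced. Let $\tau$ be a finite relational signature. The age of a $\tau$-structure is the class of all finite $\tau$-structures that embed into it. A class $\mathcal C$ of finite $\tau$-structures, and likewise a structure with age $\mathcal C$, is called: - finitely bounded iff there is a finite set $\mathcal F$ of finite $\tau$-structures such that for every finite $\tau$-structure $A$: $A\in\mathcal C$ iff no structure from $\mathcal F$ embeds into $A$; - Ramsey iff for all $k\ge 1$ and all $H,P\in\mathcal C$ there is $S\in\mathcal C$ such that for every coloring with $k$ colors of the copies of $P$ in $S$ (i.e. substructures of $S$ isomorphic to $P$) there is a copy of $H$ in $S$ all of whose copies of $P$ have the same color; - ordered iff $\tau$ contains a binary relation symbol that denotes a total order in every $A\in\mathcal C$. A structure is homogeneous iff every isomorphism between finite induced substructures extends to an automorphism of the whole structure. A structure $\Gamma$ is a reduct of a structure $\Delta$ with the same domain iff all relations of $\Gamma$ are first-order definable (without parameters) in $\Delta$. A first-order formula is primitive positive iff it is of the form $\exists y_1\ldots\exists y_m.\,\psi$ with $\psi$ a conjunction of atomic formulas (equality is allowed as an atomic formula). For a fixed structure $\Gamma$ with finite relational signature $\sigma$, the problem $\operatorname{Expr}_{\operatorname{pp}}(\Gamma)$ is the following. Input: quantifier-free $\sigma$-formulas $\phi_0,\phi_1,\dots,\phi_n$ (equality allowed), each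 with a given list of free variables, defining relations $R_0,R_1,\dots,R_n$ over the domain $D$ of $\Gamma$. Question: is there a primitive positive formula over a signature consisting of symbols for $R_1,\dots,R_n$ which defines $R_0$ in the structure $(D;R_1,\dots,R_n)$? Decidable means that there is an algorithm (for the fixed $\Gamma$) that answers the question correctly on every input. *)

(* Defs.v *)
From mathcomp Require Import all_boot.

Set Implicit Arguments.
Unset Strict Implicit.
Unset Printing Implicit Defensive.

Record signature := Signature { symbol :> finType; arity : symbol -> nat }.

(* A structure is given as an interpretation over an explicit domain, so that
   two structures with the same domain are two terms over the same [D]. *)
Definition structure (sg : signature) (D : Type) :=
  forall R : sg, (arity R).-tuple D -> Prop.

Record finStructure (sg : signature) := FinStructure {
  fin_dom :> finType;
  fin_str : structure sg fin_dom
}.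

Arguments fin_str {sg} f.

Section Structures.
Variable sg : signature.
Implicit Types (T U : Type) (C : finStructure sg -> Prop).

Definition strong_hom T U (A : structure sg T) (B : structure sg U)
    (f : T -> U) :=
  forall (R : sg) (t : (arity R).-tuple T), A R t <-> B R (map_tuple f t).

Definition embedding T U (A : structure sg T) (B : structure sg U)
    (f : T -> U) := injective f /\ strong_hom A B f.

Definition isomorphism T U (A : structure sg T) (B : structure sg U)
    (f : T -> U) := bijective f /\ strong_hom A B f.

Definition embeds T U (A : structure sg T) (B : structure sg U) :=
  exists f : T -> U, embedding A B f.

Definition isomorphic T U (A : structure sg T) (B : structure sg U) :=
  exists f : T -> U, isomorphism A B f.

Definition induced T (A : structure sg T) (X : pred T) :
    structure sg {x : T | X x} :=
  fun R t => A R (map_tuple sval t).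

#[global] Arguments induced {T} A X.

Definition age T (A : structure sg T) : finStructure sg -> Prop :=
  fun B => embeds (fin_str B) A.

Definition finitely_bounded C :=
  exists (m : nat) (F : 'I_m -> finStructure sg),
    forall A, C A <-> forall i, ~ embeds (fin_str (F i)) (fin_str A).

Definition is_copy (P S : finStructure sg) (X : {set S}) :=
  isomorphic (fin_str P) (induced (fin_str S) (fun x => x \in X)).

(* A colouring is extended arbitrarily to the subsets of [S] that are not
   copies of [P]; those values are never used. *)
Definition ramsey C :=
  forall (k : nat) (H P : finStructure sg), 0 < k -> C H -> C P ->
  exists S : finStructure sg, C S /\
    forall chi : {set S} -> 'I_k,
    exists Y : {set S}, is_copy H Y /\
      exists c : 'I_k,
        forall X : {set S}, X \subset Y -> is_copy P X -> chi X = c.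

(* Both conventions for a total order, reflexive and strict, are admitted. *)
Definition total_order T (r : T -> T -> Prop) :=
  [/\ forall x y z, r x y -> r y z -> r x z,
      forall x y, r x y -> r y x -> x = y,
      forall x y, x <> y -> r x y \/ r y x
    & (forall x, r x x) \/ (forall x, ~ r x x)].

Definition ordered C :=
  exists (R : sg) (ar2 : 2 = arity R),
    forall A : finStructure sg, C A ->
      total_order (fun x y : A => fin_str A R (tcast ar2 [tuple x; y])).

Definition finite_pred (T : eqType) (X : pred T) :=
  exists s : seq T, {subset X <= s}.

Definition homogeneous (D : eqType) (A : structure sg D) :=
  forall X Y : pred D, finite_pred X -> finite_pred Y ->
  forall f : {x : D | X x} -> {y : D | Y y},
    isomorphism (induced A X) (induced A Y) f ->
    exists g : D -> D,
      isomorphism A A g /\ forall x, g (sval x) = sval (f x).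

End Structures.

Inductive formula (sg : signature) :=
| fEq of nat & nat
| fRel (R : sg) of (arity R).-tuple nat
| fNot of formula sg
| fAnd of formula sg & formula sg
| fOr of formula sg & formula sg
| fEx of nat & formula sg
| fAll of nat & formula sg.

Arguments fEq {sg}.

Section Formulas.
Variable sg : signature.

Fixpoint sat (D : Type) (A : structure sg D) (e : nat -> D)
    (phi : formula sg) : Prop :=
  match phi with
  | fEq i j => e i = e j
  | fRel R v => A R (map_tuple e v)
  | fNot p => ~ sat A e p
  | fAnd p q => sat A e p /\ sat A e q
  | fOr p q => sat A e p \/ sat A e q
  | fEx i p => exists d : D, sat A [eta e with i |-> d] p
  | fAll i p => forall d : D, sat A [eta e with i |-> d] p
  end.

Fixpoint free_vars (phi : formula sg) : seq nat :=
  match phi with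
  | fEq i j => [:: i; j]
  | fRel _ v => v
  | fNot p => free_vars p
  | fAnd p q | fOr p q => free_vars p ++ free_vars q
  | fEx i p | fAll i p => [seq j <- free_vars p | j != i]
  end.

Fixpoint quantifier_free (phi : formula sg) : bool :=
  match phi with
  | fEq _ _ | fRel _ _ => true
  | fNot p => quantifier_free p
  | fAnd p q | fOr p q => quantifier_free p && quantifier_free q
  | fEx _ _ | fAll _ _ => false
  end.

Fixpoint conj_of_atoms (phi : formula sg) : bool :=
  match phi with
  | fEq _ _ | fRel _ _ => true
  | fAnd p q => conj_of_atoms p && conj_of_atoms q
  | _ => false
  end.

Fixpoint primitive_positive (phi : formula sg) : bool :=
  match phi with
  | fEx _ p => primitive_positive p
  | _ => conj_of_atoms phi
  end.

(* [phi(xs_0, ..., xs_(k-1))] defines [R] in [A]; as [xs] is duplicate-free,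
   every k-tuple over a nonempty [D] is of the form [map_tuple e xs]. *)
Definition defines (D : Type) (A : structure sg D) k (xs : k.-tuple nat)
    (phi : formula sg) (R : k.-tuple D -> Prop) :=
  [/\ uniq xs, {subset free_vars phi <= xs}
    & forall e : nat -> D, R (map_tuple e xs) <-> sat A e phi].

End Formulas.

Definition reduct (sg tau : signature) (D : Type)
    (G : structure sg D) (A : structure tau D) :=
  forall R : sg, exists (xs : (arity R).-tuple nat) (phi : formula tau),
    defines A xs phi (G R).

Record qf_def (sg : signature) := QfDef {
  qf_vars : seq nat;
  qf_form : formula sg
}.

Section Expr.
Variable sg : signature.
Implicit Types (d : qf_def sg) (ds : seq (qf_def sg)).

Definition wf_qf_def d : bool :=
  [&& quantifier_free (qf_form d), uniq (qf_vars d)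
    & all (fun i => i \in qf_vars d) (free_vars (qf_form d))].

Definition qf_rel (D : Type) (G : structure sg D) d :
    (size (qf_vars d)).-tuple D -> Prop :=
  fun t => exists e : nat -> D,
    map_tuple e (in_tuple (qf_vars d)) = t /\ sat G e (qf_form d).

#[global] Arguments qf_rel {D} G d.

Definition defs_sig ds : signature :=
  @Signature 'I_(size ds) (fun i => size (qf_vars (tnth (in_tuple ds) i))).

Definition defs_str (D : Type) (G : structure sg D) ds :
    structure (defs_sig ds) D :=
  fun i => qf_rel G (tnth (in_tuple ds) i).

#[global] Arguments defs_str {D} G ds.

Definition pp_expressible (D : Type) (G : structure sg D) d0 ds :=
  exists (xs : (size (qf_vars d0)).-tuple nat) (psi : formula (defs_sig ds)),
    primitive_positive psi /\ defines (defs_str G ds) xs psi (qf_rel G d0).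

End Expr.

(* Model of computation: the partial recursive functions over binary trees,
   that is, Kleene's schemes with pairing built in, structural recursion on
   trees in place of primitive recursion on numbers, and a while loop in place
   of minimisation. *)
Inductive tree := Nil | Cons of tree & tree.

Definition hd (x : tree) := if x is Cons a _ then a else Nil.
Definition tl (x : tree) := if x is Cons _ b then b else Nil.

Inductive prog :=
| pId
| pNil
| pHd
| pTl
| pCons of prog & prog
| pComp of prog & prog
| pRec of prog & prog
| pWhile of prog & prog.

(* [eval p x y]: on input [x] the program [p] terminates with output [y]. *)
Inductive eval : prog -> tree -> tree -> Prop :=
| eval_Id x : eval pId x x
| eval_Nil x : eval pNil x Nil
| eval_Hd x : eval pHd x (hd x)
| eval_Tl x : eval pTl x (tl x)
| eval_Cons p q x a b :
    eval p x a -> eval q x b -> eval (pCons p q) x (Cons a b)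
| eval_Comp p q x y z :
    eval q x y -> eval p y z -> eval (pComp p q) x z
| eval_Rec p q x z : eval_rec p q (hd x) (tl x) z -> eval (pRec p q) x z
| eval_While_stop c p x : eval c x Nil -> eval (pWhile c p) x x
| eval_While_step c p x a b y z :
    eval c x (Cons a b) -> eval p x y -> eval (pWhile c p) y z ->
    eval (pWhile c p) x z
(* Recursion on the first tree; the second one is a parameter. *)
with eval_rec : prog -> prog -> tree -> tree -> tree -> Prop :=
| eval_rec_Nil p q y z : eval p y z -> eval_rec p q Nil y z
| eval_rec_Cons p q a b y u v z :
    eval_rec p q a y u -> eval_rec p q b y v ->
    eval q (Cons (Cons a b) (Cons (Cons u v) y)) z ->
    eval_rec p q (Cons a b) y z.

Scheme eval_mind := Minimality for eval Sort Prop
  with eval_rec_mind := Minimality for eval_rec Sort Prop.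

Lemma eval_fun p x y z : eval p x y -> eval p x z -> y = z.
Proof.
move=> h; move: z; move: p x y h.
apply: (@eval_mind (fun p x y => forall z, eval p x z -> y = z)
  (fun p q x w y => forall z, eval_rec p q x w z -> y = z)).
- by move=> x z h; inversion h.
- by move=> x z h; inversion h.
- by move=> x z h; inversion h.
- by move=> x z h; inversion h.
- move=> p q x a b _ IHp _ IHq z h; inversion h; subst.
  by rewrite (IHp a0) // (IHq b0).
- move=> p q x y z _ IHq _ IHp z' h; inversion h; subst.
  by apply: IHp; rewrite (IHq y0).
- by move=> p q x z _ IH z' h; inversion h; subst; apply: IH.
- move=> c p x _ IH z h; inversion h; subst=> //.
  by have := IH _ H1.
- move=> c p x a b y z _ IHc _ IHp _ IHw z' h; inversion h; subst.
    by have := IHc _ H3.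
  by apply: IHw; rewrite (IHp y0).
- by move=> p q y z _ IH z' h; inversion h; subst; apply: IH.
- move=> p q a b y u v z _ IHa _ IHb _ IHq z' h; inversion h; subst.
  by apply: IHq; rewrite (IHa u0) // (IHb v0).
Qed.

Definition code_nat (n : nat) : tree := iter n (Cons Nil) Nil.

Definition code_bool (b : bool) : tree := code_nat b.

Definition code_seq (T : Type) (code : T -> tree) (s : seq T) : tree :=
  foldr (fun x => Cons (code x)) Nil s.

Section Codes.
Variable sg : signature.

(* The fixed finite signature is coded by numbering its symbols. *)
Fixpoint code_formula (phi : formula sg) : tree :=
  match phi with
  | fEq i j => Cons (code_nat 0) (Cons (code_nat i) (code_nat j))
  | fRel R v =>
      Cons (code_nat 1) (Cons (code_nat (enum_rank R)) (code_seq code_nat v))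
  | fNot p => Cons (code_nat 2) (code_formula p)
  | fAnd p q => Cons (code_nat 3) (Cons (code_formula p) (code_formula q))
  | fOr p q => Cons (code_nat 4) (Cons (code_formula p) (code_formula q))
  | fEx i p => Cons (code_nat 5) (Cons (code_nat i) (code_formula p))
  | fAll i p => Cons (code_nat 6) (Cons (code_nat i) (code_formula p))
  end.

Definition code_qf_def (d : qf_def sg) : tree :=
  Cons (code_seq code_nat (qf_vars d)) (code_formula (qf_form d)).

Definition Expr_pp_decidable (D : Type) (G : structure sg D) :=
  exists p : prog, forall (d0 : qf_def sg) (ds : seq (qf_def sg)),
    all (@wf_qf_def sg) (d0 :: ds) ->
    exists b : bool,
      eval p (code_seq code_qf_def (d0 :: ds)) (code_bool b) /\
      (b <-> pp_expressible G d0 ds).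

End Codes.

(* Main.v *)
From mathcomp Require Import all_boot boolp.
Require Import Defs.

Set Implicit Arguments.
Unset Strict Implicit.
Unset Printing Implicit Defensive.

(** The proof reduces definability to a finite search.

    Let [R0], ..., [Rn] be the relations given by the input. Since [Delta] is
    homogeneous, they are unions of orbits of its automorphism group, and
    orbits of tuples are atomic types. Choose tuples [t1], ..., [tm] that
    represent all orbits contained in [R0], and view them as the columns of a
    matrix, whose rows are points of [D^m]. Then [R0] is not primitive positive
    definable from [R1], ..., [Rn] if and only if on every finite set of points
    of [D^m] there is a function to [D] that preserves [R1], ..., [Rn] and maps
    the rows to a tuple outside [R0] ([violates_not_pp], [not_pp_violates]):
    the conjunction of all atoms that hold in all coordinates of a finite set
    of points is the strongest primitive positive formula that can be imposed
    on that many variables while keeping [t1], ..., [tm] among its solutions.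

    By the Ramsey property such functions can be taken canonical: the type of
    the images of [b] points, for a fixed [b], depends only on the type in
    [Delta] of these points and the rows ([violates_nondef]). A single Ramsey
    argument suffices, without constants and without products. The type of
    points of [D^m] is taken to be the type of the tuple of all their
    coordinates in [Delta], so that only embeddings of [Delta] in itself are
    applied, the same one in each coordinate. The coloured pattern is a finite
    set [X] that contains the rows and points of all types over them, and the
    colour of a copy of [X] is the complete table of values of a function
    chosen for the copy of the rows inside it; thus the constants move along
    with the pattern.

    A canonical function is described by a finite table, its behaviour.
    Conversely a behaviour comes from functions on all finite sets as soon as
    it produces realizable types ([nondef_violates]). This can be tested,
    because [Delta] is finitely bounded: a type is realized if and only if all
    its restrictions to [b] points are ([realizableP]), once [b] exceeds the
    size of the forbidden structures and twice the arities. So definability is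
    decided by running through all behaviours ([nondefP]), and this search is
    expressed by structural recursion alone ([prog_nondef]). *)

(** * Computable functions *)

Fixpoint tree_fold (A : Type) (z : A) (f : tree -> tree -> A -> A -> A) t : A :=
  match t with
  | Nil => z
  | Cons a b => f a b (tree_fold z f a) (tree_fold z f b)
  end.

(** Programs without loops always terminate, so that they denote total
    functions on trees, which [run] computes. Termination on every tree matters
    below: [pRec] also visits the subtrees of a code that encode nothing. *)
Fixpoint while_free (p : prog) : bool :=
  match p with
  | pCons p q | pComp p q | pRec p q => while_free p && while_free q
  | pWhile _ _ => false
  | _ => true
  end.

Fixpoint run (p : prog) (x : tree) : tree :=
  match p with
  | pId | pWhile _ _ => x
  | pNil => Nil
  | pHd => hd x
  | pTl => tl x
  | pCons p q => Cons (run p x) (run q x)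
  | pComp p q => run p (run q x)
  | pRec p q => tree_fold (run p (tl x))
      (fun a b u v => run q (Cons (Cons a b) (Cons (Cons u v) (tl x)))) (hd x)
  end.

Lemma eval_run p x : while_free p -> eval p x (run p x).
Proof.
elim: p x => [||||p IHp q IHq|p IHp q IHq|p IHp q IHq|] x //=; try by constructor.
- by case/andP=> hp hq; constructor; [apply: IHp | apply: IHq].
- by case/andP=> hp hq; apply: eval_Comp; [apply: IHq | apply: IHp].
- case/andP=> hp hq; constructor; elim: (hd x) => [|a IHa b IHb] /=.
    by constructor; apply: IHp.
  by apply: eval_rec_Cons IHa IHb _; apply: IHq.
Qed.

Class coded (A : Type) := code : A -> tree.

#[local] Instance coded_tree : coded tree := id.
#[local] Instance coded_nat : coded nat := code_nat.
#[local] Instance coded_bool : coded bool := code_bool.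
#[local] Instance coded_seq A (c : coded A) : coded (seq A) := code_seq code.
#[local] Instance coded_prod A B (cA : coded A) (cB : coded B) : coded (A * B) :=
  fun x => Cons (code x.1) (code x.2).

(** The lemmas [c_f] below say that computable functions of a state [e : E] are
    closed under the operation [f]. Bound variables of a function argument of
    [f] are added to the state by pairing. *)
Definition computable A B (cA : coded A) (cB : coded B) (f : A -> B) :=
  exists2 p, while_free p & forall x, run p (code x) = code (f x).

Arguments computable {A B cA cB} f.

Section Closure.
Context {E : Type} {cE : coded E}.

Lemma c_id : computable (fun e : E => e).
Proof. by exists pId. Qed.

Lemma c_comp A B (cA : coded A) (cB : coded B) (g : A -> B) (f : E -> A) :
  computable g -> computable f -> computable (fun e => g (f e)).
Proof.
case=> p hp ep [q hq eq]; exists (pComp p q) => /= [|x]; first by rewrite hp.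
by rewrite eq ep.
Qed.

Lemma c_tree (t : tree) : computable (fun _ : E => t).
Proof.
elim: t => [|a [p hp ep] b [q hq eq]]; first by exists pNil.
by exists (pCons p q) => [|x] /=; [rewrite hp | rewrite ep eq].
Qed.

Lemma c_const A (cA : coded A) (a : A) : computable (fun _ : E => a).
Proof. by case: (c_tree (code a)) => p hp ep; exists p. Qed.

Lemma c_pair A B (cA : coded A) (cB : coded B) (f : E -> A) (g : E -> B) :
  computable f -> computable g -> computable (fun e => (f e, g e)).
Proof.
case=> p hp ep [q hq eq]; exists (pCons p q) => [|x] /=; first by rewrite hp.
by rewrite ep eq.
Qed.

Lemma c_fst A B (cA : coded A) (cB : coded B) (f : E -> A * B) :
  computable f -> computable (fun e => (f e).1).
Proof.
by case=> p hp ep; exists (pComp pHd p) => //= x; rewrite ep; case: (f x).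
Qed.

Lemma c_snd A B (cA : coded A) (cB : coded B) (f : E -> A * B) :
  computable f -> computable (fun e => (f e).2).
Proof.
by case=> p hp ep; exists (pComp pTl p) => //= x; rewrite ep; case: (f x).
Qed.

Lemma c_Cons f g : computable f -> computable g ->
  computable (fun e : E => Cons (f e) (g e)).
Proof.
case=> p hp ep [q hq eq]; exists (pCons p q) => [|x] /=; first by rewrite hp.
by rewrite ep eq.
Qed.

Lemma c_hd f : computable f -> computable (fun e : E => hd (f e)).
Proof. by case=> p hp ep; exists (pComp pHd p) => //= x; rewrite ep. Qed.

Lemma c_tl f : computable f -> computable (fun e : E => tl (f e)).
Proof. by case=> p hp ep; exists (pComp pTl p) => //= x; rewrite ep. Qed.

(** The step of [pRec] receives [((a, b), ((u, v), y))], where [a] and [b] are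
    the subtrees, [u] and [v] the results on them, and [y] the parameter. The
    state of [F] is grouped in the same way. *)
Lemma c_tree_fold A (cA : coded A) (z : E -> A)
    (F : E -> tree -> tree -> A -> A -> A) (t : E -> tree) :
  computable t -> computable z ->
  computable (fun x : (tree * tree) * ((A * A) * E) =>
    F x.2.2 x.1.1 x.1.2 x.2.1.1 x.2.1.2) ->
  computable (fun e => tree_fold (z e) (F e) (t e)).
Proof.
case=> pt ht et [pz hz ez] [q hq eq].
exists (pComp (pRec pz q) (pCons pt pId)) => [|x] /=; first by rewrite hz hq ht.
rewrite et; elim: (t x : tree) => [|a IHa b IHb] /=; first exact: ez.
rewrite IHa IHb.
exact: (eq ((a, b), ((tree_fold (z x) (F x) a, tree_fold (z x) (F x) b), x))).
Qed.

Lemma c_foldr A B (cA : coded A) (cB : coded B) (F : E -> A -> B -> B) z l :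
  computable l -> computable z ->
  computable (fun x : E * (A * B) => F x.1 x.2.1 x.2.2) ->
  computable (fun e => foldr (F e) (z e) (l e)).
Proof.
case=> pl hl el [pz hz ez] [q hq eq].
pose arg := pCons (pComp pTl pTl)
  (pCons (pComp pHd pHd) (pComp pTl (pComp pHd pTl))).
exists (pComp (pRec pz (pComp q arg)) (pCons pl pId)) => [|x] /=.
  by rewrite hz hq hl.
rewrite el; elim: (l x) => [|a s IHs] /=; first exact: ez.
by rewrite IHs; exact: (eq (x, (a, foldr (F x) (z x) s))).
Qed.

Lemma c_iter A (cA : coded A) (F : E -> A -> A) z n :
  computable n -> computable z -> computable (fun x : E * A => F x.1 x.2) ->
  computable (fun e => iter (n e) (F e) (z e)).
Proof.
case=> pn hn en [pz hz ez] [q hq eq].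
pose arg := pCons (pComp pTl pTl) (pComp pTl (pComp pHd pTl)).
exists (pComp (pRec pz (pComp q arg)) (pCons pn pId)) => [|x] /=.
  by rewrite hz hq hn.
rewrite en; elim: (n x) => [|m IHm] /=; first exact: ez.
by rewrite IHm; exact: (eq (x, iter m (F x) (z x))).
Qed.

Lemma c_if A (cA : coded A) (c : E -> bool) f g :
  computable c -> computable f -> computable g ->
  computable (fun e => if c e then f e else g e : A).
Proof.
case=> pc hc ec [pf hf ef] [pg hg eg].
exists (pComp (pRec pg (pComp pf (pComp pTl pTl))) (pCons pc pId)) => [|x] /=.
  by rewrite hf hg hc.
by rewrite ec; case: (c x) => /=; rewrite ?ef ?eg.
Qed.

Lemma c_negb f : computable f -> computable (fun e : E => ~~ f e).
Proof. by move=> cf; apply: c_if => //; apply: c_const. Qed.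

Lemma c_andb f g : computable f -> computable g ->
  computable (fun e : E => f e && g e).
Proof. by move=> cf cg; apply: c_if => //; apply: c_const. Qed.

Lemma c_orb f g : computable f -> computable g ->
  computable (fun e : E => f e || g e).
Proof. by move=> cf cg; apply: c_if => //; apply: c_const. Qed.

Lemma c_implyb f g : computable f -> computable g ->
  computable (fun e : E => f e ==> g e).
Proof. by move=> cf cg; apply: c_if => //; apply: c_const. Qed.

Lemma c_S n : computable n -> computable (fun e : E => (n e).+1).
Proof. by case=> p hp ep; exists (pCons pNil p) => //= x; rewrite ep. Qed.

Lemma c_pred n : computable n -> computable (fun e : E => (n e).-1).
Proof.
by case=> p hp ep; exists (pComp pTl p) => //= x; rewrite ep; case: (n x).
Qed.

Lemma c_cons A (cA : coded A) (a : E -> A) s :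
  computable a -> computable s -> computable (fun e => a e :: s e).
Proof.
case=> p hp ep [q hq eq]; exists (pCons p q) => [|x] /=; first by rewrite hp.
by rewrite ep eq.
Qed.

Lemma c_behead A (cA : coded A) (s : E -> seq A) :
  computable s -> computable (fun e => behead (s e)).
Proof.
by case=> p hp ep; exists (pComp pTl p) => //= x; rewrite ep; case: (s x).
Qed.

End Closure.

Lemma c_ext E A (cE : coded E) (cA : coded A) (f g : E -> A) :
  f =1 g -> computable g -> computable f.
Proof. by move=> fg [p hp ep]; exists p => // x; rewrite ep fg. Qed.

(* Proves that a component of the state, a nest of pairs, is computable. *)
Ltac c_var := lazymatch goal with
  | |- computable (fun x => fst (@?f x)) => apply: (c_fst (f := f)); c_var
  | |- computable (fun x => snd (@?f x)) => apply: (c_snd (f := f)); c_var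
  | |- computable fst => exact: (c_fst c_id)
  | |- computable snd => exact: (c_snd c_id)
  | |- _ => exact: c_id
  end.

Lemma c_add E (cE : coded E) m n : computable m -> computable n ->
  computable (fun e : E => m e + n e).
Proof.
move=> cm cn; apply: (@c_ext _ _ _ _ _ (fun e => iter (m e) S (n e))).
  by move=> e; rewrite iter_succn addnC.
by apply: c_iter => //; apply: c_S; c_var.
Qed.

Lemma c_mul E (cE : coded E) m n : computable m -> computable n ->
  computable (fun e : E => m e * n e).
Proof.
move=> cm cn; apply: (@c_ext _ _ _ _ _ (fun e => iter (m e) (addn (n e)) 0)).
  by move=> e; rewrite iter_addn_0 mulnC.
apply: c_iter => //; first exact: c_const.
by apply: c_add; [apply: (c_comp cn); c_var | c_var].
Qed.

Lemma c_eqn E (cE : coded E) (m n : E -> nat) : computable m -> computable n ->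
  computable (fun e : E => m e == n e).
Proof.
have csub f g : computable f -> computable g ->
    computable (fun e : E => f e - g e).
  move=> cf cg; apply: (@c_ext _ _ _ _ _ (fun e => iter (g e) predn (f e))).
    by move=> e; elim: (g e) => [|k /= <-]; rewrite ?subn0 ?subnS.
  by apply: c_iter => //; apply: c_pred; c_var.
move=> cm cn.
apply: (@c_ext _ _ _ _ _
  (fun e => iter ((m e - n e) + (n e - m e)) (fun=> false) true)).
  by move=> e /=; rewrite eqn_leq -!subn_eq0 -addn_eq0; case: (_ + _).
apply: c_iter; [|exact: c_const|exact: c_const].
by apply: c_add; apply: csub.
Qed.

Section Lists.
Variables (E A B : Type) (cE : coded E) (cA : coded A) (cB : coded B).
Implicit Types l : E -> seq A.

Lemma c_map (F : E -> A -> B) l : computable l ->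
  computable (fun x : E * A => F x.1 x.2) ->
  computable (fun e => [seq F e a | a <- l e]).
Proof.
move=> cl cF.
apply: (@c_ext _ _ _ _ _ (fun e => foldr (fun a s => F e a :: s) [::] (l e))).
  by move=> e; elim: (l e) => //= a s ->.
apply: c_foldr => //; first exact: c_const.
apply: c_cons; last by c_var.
by apply: (c_comp (f := fun x => (x.1, x.2.1)) cF); apply: c_pair; c_var.
Qed.

Lemma c_has (P : E -> A -> bool) l : computable l ->
  computable (fun x : E * A => P x.1 x.2) ->
  computable (fun e => has (P e) (l e)).
Proof.
move=> cl cP.
apply: (@c_ext _ _ _ _ _ (fun e => foldr (fun a s => P e a || s) false (l e))).
  by move=> e; elim: (l e) => //= a s ->.
apply: c_foldr => //; first exact: c_const.
apply: c_orb; last by c_var.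
by apply: (c_comp (f := fun x => (x.1, x.2.1)) cP); apply: c_pair; c_var.
Qed.

Lemma c_all (P : E -> A -> bool) l : computable l ->
  computable (fun x : E * A => P x.1 x.2) ->
  computable (fun e => all (P e) (l e)).
Proof.
move=> cl cP; apply: (@c_ext _ _ _ _ _ (fun e => ~~ has (predC (P e)) (l e))).
  by move=> e; rewrite has_predC negbK.
by apply: c_negb; apply: c_has => //=; apply: c_negb.
Qed.

Lemma c_filter (P : E -> A -> bool) l : computable l ->
  computable (fun x : E * A => P x.1 x.2) ->
  computable (fun e => [seq a <- l e | P e a]).
Proof.
move=> cl cP.
apply: (@c_ext _ _ _ _ _
    (fun e => foldr (fun a s => if P e a then a :: s else s) [::] (l e))).
  by move=> e; elim: (l e) => //= a s ->.
apply: c_foldr => //; first exact: c_const.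
apply: c_if; [|apply: c_cons; c_var|by c_var].
by apply: (c_comp (f := fun x => (x.1, x.2.1)) cP); apply: c_pair; c_var.
Qed.

Lemma c_cat l l' : computable l -> computable l' ->
  computable (fun e => l e ++ l' e).
Proof.
move=> cl cl'; apply: (@c_ext _ _ _ _ _ (fun e => foldr cons (l' e) (l e))).
  by move=> e; elim: (l e) => //= a s ->.
by apply: c_foldr => //; apply: c_cons; c_var.
Qed.

Lemma c_size l : computable l -> computable (fun e => size (l e)).
Proof.
move=> cl; apply: (@c_ext _ _ _ _ _ (fun e => foldr (fun _ n => n.+1) 0 (l e))).
  by move=> e; elim: (l e) => //= a s ->.
by apply: c_foldr; [|exact: c_const|apply: c_S; c_var].
Qed.

Lemma c_head a l : computable l -> computable (fun e => head a (l e)).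
Proof.
move=> cl; apply: (@c_ext _ _ _ _ _ (fun e => foldr (fun x _ => x) a (l e))).
  by move=> e; elim: (l e).
by apply: c_foldr; [|exact: c_const|c_var].
Qed.

Lemma c_nth (a : E -> A) l n : computable a -> computable l -> computable n ->
  computable (fun e => nth (a e) (l e) (n e)).
Proof.
move=> ca cl cn.
apply: (@c_ext _ _ _ _ _ (fun e =>
  foldr (fun x _ => x) (a e) (iter (n e) behead (l e)))).
  by move=> e; rewrite -drop_behead -[n e in LHS]addn0 -nth_drop; case: (drop _ _).
by apply: c_foldr => //; [apply: c_iter => //; apply: c_behead|]; c_var.
Qed.

End Lists.

Lemma c_flatten E (cE : coded E) A (cA : coded A) (l : E ->
  seq (seq A)) : computable l ->
  computable (fun e => flatten (l e)).
Proof.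
move=> cl; apply: c_foldr => //; first exact: c_const.
by apply: c_cat; c_var.
Qed.

Lemma c_iota E (cE : coded E) m n : computable m -> computable n ->
  computable (fun e : E => iota (m e) (n e)).
Proof.
move=> cm cn; apply: (@c_ext _ _ _ _ _
    (fun e => iter (n e) (fun s => m e :: map S s) [::])).
  by move=> e; elim: (n e) (m e) => //= k IHk j;
    rewrite -IHk -[j.+1]addn1 addnC iotaDl.
apply: c_iter => //; first exact: c_const.
apply: c_cons; first by apply: (c_comp cm); c_var.
by apply: c_map; [|apply: c_S]; c_var.
Qed.

(** Codes are compared through an injective numbering of trees, since [pRec]
    cannot recurse on two trees at once. *)
Definition tree_num : tree -> nat :=
  tree_fold 0 (fun _ _ m n => 2 ^ m * (n.*2).+1).

Lemma tree_num_inj : injective tree_num.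
Proof.
have num a b : tree_num (Cons a b) = 2 ^ tree_num a * (tree_num b).*2.+1 by [].
have pos a b : 0 < tree_num (Cons a b) by rewrite num muln_gt0 expn_gt0.
have odd2 k : logn 2 k.*2.+1 = 0 by rewrite lognE dvdn2 /= odd_double.
elim=> [|a IHa b IHb] [|a' b'] //= e.
- by have := pos a' b'; rewrite -e.
- by have := pos a b; rewrite e.
move: e; rewrite !num => e.
have la : tree_num a = tree_num a'.
  have := congr1 (logn 2) e.
  by rewrite !lognM ?expn_gt0 // !odd2 !pfactorK // !addn0.
congr Cons; first exact: IHa.
by move/eqP: e; rewrite la eqn_pmul2l ?expn_gt0 // eqSS => /eqP/double_inj/IHb.
Qed.

Lemma c_tree_num E (cE : coded E) (t : E -> tree) : computable t ->
  computable (fun e => tree_num (t e)).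
Proof.
move=> ct; apply: c_tree_fold => //; first exact: c_const.
apply: c_mul.
  apply: (@c_ext _ _ _ _ _ (fun x => iter x.2.1.1 (muln 2) 1)).
    by move=> x; rewrite iter_muln muln1.
  apply: c_iter; [c_var|exact: c_const|].
  by apply: c_mul; [exact: c_const|c_var].
apply: c_S; apply: (@c_ext _ _ _ _ _ (fun x => x.2.1.2 + x.2.1.2)).
  by move=> x; rewrite addnn.
by apply: c_add; c_var.
Qed.

Lemma c_eq E (cE : coded E) (A : eqType) (cA : coded A) (f g : E -> A) :
  injective (code : A -> tree) -> computable f -> computable g ->
  computable (fun e => f e == g e).
Proof.
move=> inj cf cg.
apply: (@c_ext _ _ _ _ _
  (fun e => tree_num (code (f e)) == tree_num (code (g e)))).
  move=> e; apply/eqP/eqP => [->//|/tree_num_inj]; exact: inj.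
by apply: c_eqn; apply: c_tree_num; [case: cf|case: cg] => p hp ep; exists p.
Qed.

Lemma c_index E (cE : coded E) (A : eqType) (cA : coded A) (a : E -> A) l :
  injective (code : A -> tree) -> computable a -> computable l ->
  computable (fun e => index (a e) (l e)).
Proof.
move=> inj ca cl; apply: (@c_ext _ _ _ _ _
    (fun e => foldr (fun x n => if x == a e then 0 else n.+1) 0 (l e))).
  by move=> e; rewrite /index; elim: (l e) => //= x s ->; case: eqP.
apply: c_foldr => //; first exact: c_const.
apply: c_if; last by apply: c_S; c_var.
  by apply: c_eq => //; [|apply: (c_comp ca)]; c_var.
exact: c_const.
Qed.

Lemma c_mem E (cE : coded E) (A : eqType) (cA : coded A) (a : E -> A) l :
  injective (code : A -> tree) -> computable a -> computable l ->
  computable (fun e => a e \in (l e : seq A)).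
Proof.
move=> inj ca cl.
apply: (@c_ext _ _ _ _ _ (fun e => has (fun x => x == a e) (l e))).
  by move=> e; apply/idP/hasP => [h|[x h /eqP <-//]]; exists (a e).
by apply: c_has => //; apply: c_eq => //; [|apply: (c_comp ca)]; c_var.
Qed.

Lemma code_nat_inj : injective code_nat.
Proof. by elim=> [|m IHm] [|n] //= [/IHm->]. Qed.

Lemma code_seq_inj A (c : A -> tree) : injective c -> injective (code_seq c).
Proof. by move=> inj; elim=> [|x s IHs] [|y r] //= [/inj-> /IHs->]. Qed.

(** * Tables and the decision procedure *)

Definition lists (A : Type) (n : nat) (l : seq A) : seq (seq A) :=
  iter n (fun acc => flatten [seq [seq x :: u | u <- acc] | x <- l]) [:: [::]].

Lemma mem_lists (A : eqType) n (l u : seq A) :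
  (u \in lists n l) = (size u == n) && all (mem l) u.
Proof.
elim: n u => [|n IHn] [|x u] //=.
  by apply/negP => /flattenP[s /mapP[y _ ->]] /mapP[].
rewrite eqSS andbCA -IHn; apply/flattenP/andP.
  by case=> _ /mapP[y ly ->] /mapP[v lv [-> ->]].
case=> lx lu; exists [seq x :: u | u <- lists n l]; last exact: map_f.
by apply/mapP; exists x.
Qed.

(** A function from [b]-tuples of indices below [n] to numbers is stored as a
    list of length [n] of such functions for [b.-1]. Equal functions have equal
    tables, and evaluation needs no arithmetic on indices. *)
Fixpoint tab (b : nat) : eqType :=
  if b is b'.+1 then seq (tab b') : eqType else nat.

Definition tab0 b : tab b := if b is b'.+1 then [::] : tab b'.+1 else 0.

Fixpoint code_tab b : tab b -> tree :=
  if b is b'.+1 then code_seq (@code_tab b') else code_nat.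

#[local] Instance coded_tab b : coded (tab b) := @code_tab b.

Lemma code_tab_inj b : injective (@code_tab b).
Proof. by elim: b => [|b IHb]; [exact: code_nat_inj | exact: code_seq_inj]. Qed.

Fixpoint lookup b : tab b -> seq nat -> nat :=
  if b is b'.+1 then
    fun q w => lookup (nth (tab0 b') q (head 0 w)) (behead w)
  else fun n _ => n.

(** The points need not be numbers: [build b xs g] tabulates the values of [g]
    on [b]-tuples from [xs] by the positions of their entries in [xs]. *)
Fixpoint build b (X : Type) (pts : seq X) (g : seq X -> nat) : tab b :=
  if b is b'.+1 then [seq build b' pts (fun u => g (x :: u)) | x <- pts]
  else g [::].

Fixpoint tabs (N b s : nat) : seq (tab b) :=
  if b is b'.+1 then lists s (tabs N b' s) else iota 0 N.

Section Tables.
Implicit Types (b N : nat).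

Lemma lookup_build b (X : Type) (x0 : X) pts g w :
  size w = b -> all (fun i => i < size pts) w ->
  lookup (build b pts g) w = g (map (nth x0 pts) w).
Proof.
elim: b g w => [|b IHb] g [|i w] //= [sw] /andP[ip wp].
by rewrite (nth_map x0) // IHb.
Qed.

Lemma eq_build b (X : eqType) (pts : seq X) g g' :
  (forall u, size u = b -> {subset u <= pts} -> g u = g' u) ->
  build b pts g = build b pts g'.
Proof.
elim: b g g' => [|b IHb] g g' gg' /=; first exact: gg'.
apply/eq_in_map => x xp; apply: IHb => u su up; apply: gg'; rewrite /= ?su //.
by move=> y; rewrite inE => /predU1P[->//|/up].
Qed.

Lemma build_map b (X Y : Type) (f : X -> Y) pts g :
  build b (map f pts) g = build b pts (fun u => g (map f u)).
Proof.
elim: b g => [|b IHb] g //=; rewrite -map_comp; apply: eq_map => x /=.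
by rewrite IHb.
Qed.

Lemma build_tabs b N (X : eqType) (pts : seq X) g :
  (forall u, size u = b -> {subset u <= pts} -> g u < N) ->
  build b pts g \in tabs N b (size pts).
Proof.
elim: b g => [|b IHb] g gN; first by rewrite mem_iota gN.
rewrite mem_lists size_map eqxx /=; apply/allP => _ /mapP[x xp ->] /=.
apply: IHb => u su up; apply: gN; rewrite /= ?su //.
by move=> y; rewrite inE => /predU1P[->//|/up].
Qed.

(** Tables are determined by their values: two tables of the same size can be
    compared entry by entry through [eq_build]. *)
Lemma tabsE b N s (q : tab b) :
  q \in tabs N b s -> q = build b (iota 0 s) (lookup q).
Proof.
elim: b q => [|b IHb] //= q; rewrite mem_lists => /andP[/eqP sq /allP qN].
apply: (@eq_from_nth _ (tab0 b)) => [|i]; rewrite sq ?size_map ?size_iota // => si.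
rewrite (nth_map 0) ?size_iota // nth_iota //=; apply: IHb; apply: qN.
by rewrite mem_nth ?sq.
Qed.

Lemma size_build b (X Y : Type) (pts : seq X) (pts' : seq Y) g g' :
  0 < b -> build b pts g = build b pts' g' -> size pts = size pts'.
Proof. by case: b => // b _ /= /(congr1 size); rewrite !size_map. Qed.

End Tables.

Lemma c_lists E (cE : coded E) A (cA : coded A) (n : E -> nat) (l : E -> seq A) :
  computable n -> computable l -> computable (fun e => lists (n e) (l e)).
Proof.
move=> cn cl; apply: c_iter => //; first exact: c_const.
apply: c_flatten; apply: c_map; first by apply: (c_comp cl); c_var.
by apply: c_map; [|apply: c_cons]; c_var.
Qed.

Lemma c_tabs E (cE : coded E) N b (s : E -> nat) :
  computable s -> computable (fun e => tabs N b (s e)).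
Proof.
move=> cs; elim: b => [|b IHb] /=; first exact: c_const.
exact: (c_lists cs IHb).
Qed.

Lemma c_lookup E (cE : coded E) b (q : E -> tab b) w :
  computable q -> computable w -> computable (fun e => lookup (q e) (w e)).
Proof.
elim: b q w => [|b IHb] q w cq cw /=; first exact: cq.
apply: IHb; last exact: c_behead.
by apply: c_nth; [exact: c_const | exact: cq | apply: c_head].
Qed.

Lemma c_build E (cE : coded E) b X (cX : coded X) (pts : E -> seq X) g :
  computable pts -> computable (fun x : E * seq X => g x.1 x.2) ->
  computable (fun e => build b (pts e) (g e)).
Proof.
elim: b E cE pts g => [|b IHb] E cE pts g cp cg /=.
  apply: (c_comp (f := fun e => (e, [::])) cg).
  by apply: c_pair; [c_var | exact: c_const].
apply: (c_map (F := fun e x => build b (pts e) (fun u => g e (x :: u)))) => //.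
apply: IHb; first by apply: (c_comp cp); c_var.
apply: (c_comp (f := fun x => (x.1.1, x.1.2 :: x.2)) cg).
by apply: c_pair; [|apply: c_cons]; c_var.
Qed.

(** The parameters of this section describe the structure: [N] is the number of
    colours, that is, of atomic types of [b]-tuples; the type of a list of
    points is the table of the colours of the [b]-tuples of its entries; [Kb]
    lists the types of the lists of length [b]; [eqS] and [relS] list the
    colours of the tuples whose first entries satisfy an equality or a
    relation. These are finitely many data, hence constants of the program. *)
Section Decider.
Variables (sg : signature) (N b : nat) (Kb : seq (tab b)).
Variables (eqS : seq nat) (relS : seq (seq nat)).

#[local] Instance coded_formula : coded (formula sg) := @code_formula sg.
#[local] Instance coded_qf_def : coded (qf_def sg) := @code_qf_def sg.

(** Tuples shorter than [b] are filled up with their first entry, and the empty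
    tuple with the default, in order to look up their colour. *)
Definition pad (T : Type) (x0 : T) (l : seq T) :=
  [seq nth (head x0 l) l i | i <- iota 0 b].

(** If [q] is the type of a list of points, then [pull q v] is the type of the
    list of the points with the indices [v]. *)
Definition pull (q : tab b) (v : seq nat) : tab b := build b v (lookup q).

(** By finite boundedness, a table whose restrictions to [b] indices are types
    is itself the type of some list of [L] points; see [realizableP]. *)
Definition realizable (L : nat) (q : tab b) : bool :=
  all (fun u => pull q u \in Kb) (lists b (iota 0 L)).

Definition atom (q : tab b) (S l : seq nat) : bool := lookup q (pad 0 l) \in S.

Fixpoint evalf (q : tab b) (e : nat -> nat) (phi : formula sg) : bool :=
  match phi with
  | fEq i j => atom q eqS [:: e i; e j]
  | fRel R v => atom q (nth [::] relS (enum_rank R)) [seq e x | x <- v]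
  | fNot p => ~~ evalf q e p
  | fAnd p r => evalf q e p && evalf q e r
  | fOr p r => evalf q e p || evalf q e r
  | _ => false
  end.

Definition env (A : Type) (a0 : A) (vars : seq nat) (idx : seq A) (x : nat) : A :=
  nth a0 idx (index x vars).

Definition evald (d : qf_def sg) (q : tab b) (idx : seq nat) : bool :=
  evalf q (env 0 (qf_vars d) idx) (qf_form d).

(** A list of points of [D^m] is represented by the concatenation of its
    members, so that coordinate [j] of point number [i] has index [i * m + j].
    The two functions below give the indices of a point, and those of
    coordinate [j] of the [s] points that start at number [k]. *)
Definition point (m i : nat) : seq nat := [seq i * m + j | j <- iota 0 m].
Definition column (m j k s : nat) : seq nat := [seq i * m + j | i <- iota k s].

(** A behaviour [beta] assigns a colour to every type of [k + b] points of
    [D^m]. It stands for a function [f] from [D^m] to [D] such that the colour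
    of the [f]-image of [b] points is determined by the type of these points
    together with [k] fixed points, the rows. If [q] is the type of a list of
    points of [D^m] that starts with the rows, then the table below is the type
    of the images under [f] of the points with indices [pts]. *)
Definition apply_beh (beta : seq nat) (k m : nat) (q : tab b)
    (pts : seq (seq nat)) : tab b :=
  build b pts (fun us =>
    nth 0 beta (index (pull q (iota 0 (k * m) ++ flatten us))
                      (tabs N b (k * m + b * m)))).

(** The function described by [beta] exists locally and preserves the relations
    [ds]: this is a condition on the types [q] of the rows followed by [s] more
    points. *)
Definition beh_ok (ds : seq (qf_def sg)) (k m s : nat) (p0 : tab b)
    (beta : seq nat) (q : tab b) : bool :=
  realizable ((k + s) * m) q && (pull q (iota 0 (k * m)) == p0) ==>
  (let g := apply_beh beta k m q [seq point m i | i <- iota k s] in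
   realizable s g &&
   all (fun d => all (fun j => evald d q (column m j k s)) (iota 0 m) ==>
                 evald d g (iota 0 s)) ds).

Definition nondef_with (d0 : qf_def sg) ds (k m s : nat) : bool :=
  has (fun p0 =>
    [&& realizable (k * m) p0,
        all (fun j => evald d0 p0 (column m j 0 k)) (iota 0 m) &
        has (fun beta =>
          ~~ evald d0 (apply_beh beta k m p0 [seq point m i | i <- iota 0 k])
                   (iota 0 k) &&
          all (beh_ok ds k m s p0 beta) (tabs N b ((k + s) * m)))
        (lists (size (tabs N b (k * m + b * m))) (iota 0 N))])
  (tabs N b (k * m)).

Definition types_of (d : qf_def sg) (k : nat) : seq (tab b) :=
  [seq q <- tabs N b k | realizable k q && evald d q (iota 0 k)].

(** With as many columns as there are types of tuples that satisfy [d0], some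
    choice of the rows represents all of these types. One dummy point is added
    to the tuples, since the table of an empty list does not determine the
    relations without arguments. The last argument must be at least [b] and the
    arity of each of the relations [ds]. *)
Definition nondef (ds : seq (qf_def sg)) (d0 : qf_def sg) : bool :=
  let k := (size (qf_vars d0)).+1 in
  nondef_with d0 ds k (size (types_of d0 k))
    (b + \sum_(d <- ds) size (qf_vars d)).

Section Closure.
Context {E : Type} {cE : coded E}.
Implicit Types (q : E -> tab b) (l : E -> seq nat).

Lemma c_pull q l : computable q -> computable l ->
  computable (fun e => pull (q e) (l e)).
Proof.
by move=> cq cl; apply: c_build => //; apply: c_lookup; [apply: (c_comp cq)|];
  c_var.
Qed.

Lemma c_realizable L q : computable L -> computable q ->
  computable (fun e => realizable (L e) (q e)).
Proof.
move=> cL cq; apply: c_all.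
  by apply: c_lists; [exact: c_const|apply: c_iota => //; exact: c_const].
apply: c_mem; first exact: code_tab_inj; last exact: c_const.
apply: c_build; first by c_var.
by apply: c_lookup; [apply: (c_comp cq)|]; c_var.
Qed.

Lemma c_atom q S l : computable q -> computable S -> computable l ->
  computable (fun e => atom (q e) (S e) (l e)).
Proof.
move=> cq cS cl; apply: c_mem => //; first exact: code_nat_inj.
apply: c_lookup => //; apply: c_map; first exact: c_const.
apply: c_nth; [|by apply: (c_comp cl); c_var|by c_var].
by apply: (c_head 0); apply: (c_comp cl); c_var.
Qed.

End Closure.

Definition tree_nat : tree -> nat := tree_fold 0 (fun _ _ _ n => n.+1).
Definition tree_seq : tree -> seq tree := tree_fold [::] (fun a _ _ s => a :: s).

Lemma code_natK : cancel code_nat tree_nat.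
Proof. by elim=> [|n /= {2}<-]. Qed.

Lemma code_seqK A (c : A -> tree) s : tree_seq (code_seq c s) = map c s.
Proof. by elim: s => [|x s /= <-]. Qed.

Lemma c_tree_nat E (cE : coded E) (t : E -> tree) : computable t ->
  computable (fun e => tree_nat (t e)).
Proof.
move=> ct; apply: c_tree_fold => //; first exact: c_const.
by apply: c_S; c_var.
Qed.

Lemma c_tree_seq E (cE : coded E) (t : E -> tree) : computable t ->
  computable (fun e => tree_seq (t e)).
Proof.
move=> ct; apply: c_tree_fold => //; first exact: c_const.
by apply: c_cons; c_var.
Qed.

(** The recursion on the code of a formula returns at each subtree the pair of
    its truth value and the results at its two children. In this way the node
    of a conjunction finds the values of its conjuncts, which are two levels
    below it. At subtrees that are not codes of formulas the value is junk. *)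
Definition eval_node (y : (seq nat * seq nat) * tab b) (a c v : tree) : bool :=
  let e := env 0 y.1.1 y.1.2 in
  if tree_nat a == 0 then
    atom y.2 eqS [:: e (tree_nat (hd c)); e (tree_nat (tl c))]
  else if tree_nat a == 1 then
    atom y.2 (nth [::] relS (tree_nat (hd c)))
         [seq e (tree_nat x) | x <- tree_seq (tl c)]
  else if tree_nat a == 2 then tree_nat (hd v) == 0
  else if tree_nat a == 3 then
    (tree_nat (hd (hd (tl v))) != 0) && (tree_nat (hd (tl (tl v))) != 0)
  else if tree_nat a == 4 then
    (tree_nat (hd (hd (tl v))) != 0) || (tree_nat (hd (tl (tl v))) != 0)
  else false.

Definition eval_tree y : tree -> tree :=
  tree_fold Nil (fun a c u v =>
    Cons (code_bool (eval_node y a c v)) (Cons u v)).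

Lemma eval_treeE y phi :
  hd (eval_tree y (code_formula phi)) =
  code_bool (evalf y.2 (env 0 y.1.1 y.1.2) phi).
Proof.
have bK (x : bool) : tree_nat (code_bool x) = x by case: x.
elim: phi => [i j|R v|p IHp|p IHp r IHr|p IHp r IHr|i p _|i p _] //=;
  rewrite -/(eval_tree y) /eval_node /= ?IHp ?IHr ?bK ?code_natK //.
- by rewrite code_seqK -map_comp; congr (code_bool (atom _ _ _));
    apply: eq_map => x /=; rewrite code_natK.
- by case: evalf.
- by do 2!case: evalf.
- by do 2!case: evalf.
Qed.

Lemma c_env E (cE : coded E) (vars idx : E -> seq nat) (x : E -> nat) :
  computable vars -> computable idx -> computable x ->
  computable (fun e => env 0 (vars e) (idx e) (x e)).
Proof.
move=> cv ci cx; apply: c_nth => //; first exact: c_const.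
by apply: c_index => //; exact: code_nat_inj.
Qed.

Lemma c_if_eqn E (cE : coded E) n (t : E -> tree) (f g : E -> bool) :
  computable t -> computable f -> computable g ->
  computable (fun e => if tree_nat (t e) == n then f e else g e).
Proof.
move=> ct cf cg; apply: c_if => //; apply: c_eqn; last exact: c_const.
exact: c_tree_nat.
Qed.

Lemma c_eval_node :
  computable (fun x : ((seq nat * seq nat) * tab b) * (tree * (tree * tree)) =>
    eval_node x.1 x.2.1 x.2.2.1 x.2.2.2).
Proof.
have c_zero E (cE : coded E) (t : E -> tree) : computable t ->
    computable (fun e => tree_nat (t e) == 0).
  by move=> ct; apply: c_eqn; [apply: c_tree_nat|exact: c_const].
apply: c_if_eqn; first by c_var.
  apply: c_atom; [by c_var|exact: c_const|].
  by apply: c_cons; [|apply: c_cons; [|exact: c_const]];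
    (apply: c_env; [c_var|c_var|]; apply: c_tree_nat; first
      [apply: c_hd | apply: c_tl]; c_var).
apply: c_if_eqn; first by c_var.
  apply: c_atom; first by c_var.
    apply: c_nth; [exact: c_const|exact: c_const|].
    by apply: c_tree_nat; apply: c_hd; c_var.
  apply: c_map; first by apply: c_tree_seq; apply: c_tl; c_var.
  by apply: c_env; [c_var|c_var|apply: c_tree_nat; c_var].
apply: c_if_eqn; first by c_var.
  by apply: c_zero; apply: c_hd; c_var.
apply: c_if_eqn; first by c_var.
  by apply: c_andb; apply: c_negb; apply: c_zero; apply: c_hd;
    first [apply: c_hd | apply: c_tl]; apply: c_tl; c_var.
apply: c_if_eqn; first by c_var.
  by apply: c_orb; apply: c_negb; apply: c_zero; apply: c_hd;
    first [apply: c_hd | apply: c_tl]; apply: c_tl; c_var.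
exact: c_const.
Qed.

Lemma c_vars E (cE : coded E) (d : E -> qf_def sg) :
  computable d -> computable (fun e => qf_vars (d e)).
Proof.
by case=> p hp ep; exists (pComp pHd p) => //= x; rewrite ep; case: (d x).
Qed.

Lemma c_evald E (cE : coded E) (d : E -> qf_def sg) (q : E -> tab b) idx :
  computable d -> computable q -> computable idx ->
  computable (fun e => evald (d e) (q e) (idx e)).
Proof.
move=> cd cq ci.
have cy : computable (fun e => ((qf_vars (d e), idx e), q e)).
  by apply: c_pair => //; apply: c_pair => //; apply: c_vars.
have [p hp ep] : computable (fun e => code_formula (qf_form (d e))).
  case: cd => p hp ep.
  by exists (pComp pTl p) => //= x; rewrite ep; case: (d x).
have ch : computable (fun e =>
    hd (eval_tree ((qf_vars (d e), idx e), q e) (code_formula (qf_form (d e))))).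
  apply: c_hd; apply: c_tree_fold; [by exists p|exact: c_const|].
  apply: c_Cons; last by apply: c_Cons; c_var.
  have cn : computable (fun x : (tree * tree) * ((tree * tree) * E) =>
      eval_node ((qf_vars (d x.2.2), idx x.2.2), q x.2.2) x.1.1 x.1.2 x.2.1.2).
    apply: (c_comp (f := fun x : (tree * tree) * ((tree * tree) * E) =>
      (((qf_vars (d x.2.2), idx x.2.2), q x.2.2), (x.1.1, (x.1.2, x.2.1.2))))
      c_eval_node).
    by apply: c_pair; [apply: (c_comp cy)|apply: c_pair; [|apply: c_pair]]; c_var.
  by case: cn => p' hp' ep'; exists p'.
by case: ch => p' hp' ep'; exists p' => // x; rewrite ep' eval_treeE.
Qed.

Lemma c_point E (cE : coded E) (m i : E -> nat) : computable m -> computable i ->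
  computable (fun e => point (m e) (i e)).
Proof.
move=> cm ci; apply: c_map; first by apply: c_iota => //; exact: c_const.
by apply: c_add; [apply: c_mul; [apply: (c_comp ci)|apply: (c_comp cm)]|]; c_var.
Qed.

Lemma c_column E (cE : coded E) (m j k s : E -> nat) :
  computable m -> computable j -> computable k -> computable s ->
  computable (fun e => column (m e) (j e) (k e) (s e)).
Proof.
move=> cm cj ck cs; apply: c_map; first exact: c_iota.
by apply: c_add; [apply: c_mul; [|apply: (c_comp cm)]|apply: (c_comp cj)]; c_var.
Qed.

Lemma c_apply_beh E (cE : coded E) beta k m q (pts : E -> seq (seq nat)) :
  computable beta -> computable k -> computable m -> computable q ->
  computable pts ->
  computable (fun e => apply_beh (beta e) (k e) (m e) (q e) (pts e)).
Proof.
move=> cb ck cm cq cp; apply: c_build => //.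
have cE1 A (cA : coded A) (f : E -> A) : computable f ->
    computable (fun x : E * seq (seq nat) => f x.1).
  by move=> cf; apply: (c_comp cf); c_var.
have ckm := c_mul (cE1 _ _ _ ck) (cE1 _ _ _ cm).
apply: c_nth; [exact: c_const|exact: cE1|].
apply: c_index; first exact: code_tab_inj.
  apply: c_pull; first exact: cE1.
  apply: c_cat; first by apply: c_iota => //; exact: c_const.
  by apply: c_flatten; c_var.
apply: c_tabs; apply: c_add => //; apply: c_mul; [exact: c_const|exact: cE1].
Qed.

Lemma c_points E (cE : coded E) (m k s : E -> nat) : computable m ->
  computable k -> computable s ->
  computable (fun e => [seq point (m e) i | i <- iota (k e) (s e)]).
Proof.
move=> cm ck cs; apply: c_map; first exact: c_iota.
by apply: c_point; [apply: (c_comp cm)|]; c_var.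
Qed.

Lemma c_beh_ok E (cE : coded E) ds k m s p0 beta (q : E -> tab b) :
  computable ds -> computable k -> computable m -> computable s ->
  computable p0 -> computable beta -> computable q ->
  computable (fun e => beh_ok (ds e) (k e) (m e) (s e) (p0 e) (beta e) (q e)).
Proof.
move=> cds ck cm cs cp cb cq.
have cg : computable (fun e =>
    apply_beh (beta e) (k e) (m e) (q e) [seq point (m e) i | i <- iota (k e) (s
      e)]).
  by apply: c_apply_beh => //; exact: c_points.
apply: c_implyb; apply: c_andb.
- by apply: c_realizable => //; apply: c_mul => //; exact: c_add.
- apply: c_eq => //; first exact: code_tab_inj.
  by apply: c_pull => //; apply: c_iota; [exact: c_const|exact: c_mul].
- exact: c_realizable.
apply: c_all => //; apply: c_implyb.
  apply: c_all.
    by apply: c_iota; [exact: c_const|apply: (c_comp cm); c_var].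
  apply: c_evald; [by c_var|by apply: (c_comp cq); c_var|].
  apply: c_column; [apply: (c_comp cm)| |apply: (c_comp ck)|apply: (c_comp cs)];
    by c_var.
apply: c_evald; [by c_var|by apply: (c_comp cg); c_var|].
by apply: c_iota; [exact: c_const|apply: (c_comp cs); c_var].
Qed.

Lemma c_types_of E (cE : coded E) d (k : E -> nat) : computable d -> computable k ->
  computable (fun e => types_of (d e) (k e)).
Proof.
move=> cd ck; apply: c_filter; first exact: c_tabs.
have ck1 : computable (fun x : E * tab b => k x.1).
  by apply: (c_comp ck); c_var.
apply: c_andb; first by apply: c_realizable => //; c_var.
apply: c_evald; [by apply: (c_comp cd); c_var|by c_var|].
by apply: c_iota => //; exact: c_const.
Qed.

Lemma c_nondef_with E (cE : coded E) d0 ds (k m s : E -> nat) :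
  computable d0 -> computable ds -> computable k -> computable m ->
  computable s ->
  computable (fun e => nondef_with (d0 e) (ds e) (k e) (m e) (s e)).
Proof.
move=> cd cds ck cm cs; apply: c_has; first by apply: c_tabs; exact: c_mul.
have lift A (cA : coded A) (f : E -> A) X (cX : coded X) : computable f ->
    computable (fun x : E * X => f x.1).
  by move=> cf; apply: (c_comp cf); c_var.
have lift2 A (cA : coded A) (f : E -> A) X (cX : coded X) Y (cY : coded Y) :
    computable f -> computable (fun x : E * X * Y => f x.1.1).
  by move=> cf; apply: (c_comp cf); c_var.
apply: c_andb.
  by apply: c_realizable; [apply: c_mul; apply: lift|c_var].
apply: c_andb.
  apply: c_all; first by apply: c_iota; [exact: c_const|apply: lift].
  apply: c_evald; [exact: lift2|by c_var|].
  by apply: c_column; [exact: lift2|c_var|exact: c_const|exact: lift2].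
apply: c_has.
  apply: c_lists; last exact: c_const.
  apply: c_size; apply: c_tabs; apply: c_add; apply: c_mul;
    first [exact: lift | exact: c_const].
apply: c_andb.
  apply: c_negb; apply: c_evald; first exact: lift2.
    apply: c_apply_beh; [by c_var|exact: lift2|exact: lift2|by c_var|].
    by apply: c_points; [exact: lift2|exact: c_const|exact: lift2].
  by apply: c_iota; [exact: c_const|exact: lift2].
apply: c_all.
  by apply: c_tabs; apply: c_mul; [apply: c_add|]; exact: lift2.
have lift3 A (cA : coded A) (f : E -> A) X (cX : coded X) Y (cY : coded Y)
    Z (cZ : coded Z) : computable f -> computable (fun x : E * X * Y * Z =>
      f x.1.1.1).
  by move=> cf; apply: (c_comp cf); c_var.
by apply: c_beh_ok; first [exact: lift3 | c_var].
Qed.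

Lemma c_nondef :
  computable (fun x : qf_def sg * seq (qf_def sg) => nondef x.2 x.1).
Proof.
have ck : computable
    (fun x : qf_def sg * seq (qf_def sg) => (size (qf_vars x.1)).+1).
  by apply: c_S; apply: c_size; apply: c_vars; c_var.
apply: c_nondef_with => //; try by c_var.
  by apply: c_size; apply: c_types_of => //; c_var.
apply: c_add; first exact: c_const.
apply: (@c_ext _ _ _ _ _ (fun x : qf_def sg * seq (qf_def sg) =>
  foldr (fun d n => size (qf_vars d) + n) 0 x.2)).
  by move=> [d ds] /=; elim: ds => [|c l IHl]; rewrite ?big_nil ?big_cons ?IHl.
apply: c_foldr; [by c_var|exact: c_const|].
by apply: c_add; [apply: c_size; apply: c_vars|]; c_var.
Qed.

Lemma prog_nondef : exists p : prog, forall d0 ds,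
  eval p (code_seq (@code_qf_def sg) (d0 :: ds)) (code_bool (~~ nondef ds d0)).
Proof.
have [p hp ep] := c_negb c_nondef.
exists p => d0 ds; have e := eval_run (code_seq (@code_qf_def sg) (d0 :: ds)) hp.
by have := ep (d0, ds); rewrite -[code (~~ _)]/(code_bool _) => <-; exact: e.
Qed.

End Decider.

(** * Types of tuples in a homogeneous finitely bounded structure *)

Lemma lift_tuple (T : Type) (P : pred T) (sT : subType P) n (v : n.-tuple T) :
  all P v -> exists t : n.-tuple sT, map_tuple val t = v.
Proof.
move=> /all_tnthP h; exists [tuple Sub _ (h i) | i < n].
by apply: eq_from_tnth => i; rewrite tnth_map tnth_mktuple SubK.
Qed.

Section Types.
Variables (tau : signature) (D : countType) (Delta : structure tau D).
Variables (d0 : D) (b : nat).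

(** The atomic formulas in [b] variables. *)
Definition batom := ('I_b * 'I_b + {R : tau & (arity R).-tuple 'I_b})%type.

Definition holds (u : seq D) (a : batom) : bool :=
  match a with
  | inl p => nth d0 u p.1 == nth d0 u p.2
  | inr v => `[< Delta (map_tuple (fun i : 'I_b => nth d0 u i) (tagged v)) >]
  end.

Definition truth_table (u : seq D) : {ffun batom -> bool} :=
  [ffun a => holds u a].

Definition ncolors := #|{: {ffun batom -> bool}}|.

Definition color (u : seq D) : nat := enum_rank (truth_table u).

(** This is the atomic type of [xs] in disguise: lists with equal tables
    satisfy the same atomic formulas, by [typ_same]. *)
Definition typ (xs : seq D) : tab b := build b xs color.

Definition same_atoms (xs ys : seq D) :=
  [/\ size xs = size ys,
      forall i j, i < size xs -> j < size xs ->
        (nth d0 xs i == nth d0 xs j) = (nth d0 ys i == nth d0 ys j)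
    & forall (R : tau) (v : (arity R).-tuple nat),
        all (fun i => i < size xs) v ->
        (Delta (map_tuple (nth d0 xs) v) <-> Delta (map_tuple (nth d0 ys) v))].

Definition color_holds (c : nat) (a : batom) : bool :=
  [exists f : {ffun batom -> bool}, (enum_rank f == c :> nat) && f a].

Lemma color_holdsE u a : color_holds (color u) a = holds u a.
Proof.
apply/existsP/idP => [[f /andP[/eqP/ord_inj/enum_rank_inj-> ]]|h].
  by rewrite ffunE.
by exists (truth_table u); rewrite eqxx ffunE.
Qed.

Lemma color_lt u : color u < ncolors. Proof. exact: ltn_ord. Qed.

Lemma eq_color u u' : (forall a, holds u a = holds u' a) -> color u = color u'.
Proof.
by move=> h; rewrite /color (_ : truth_table u = truth_table u') //;
  apply/ffunP => a; rewrite !ffunE.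
Qed.

Lemma color_holds_eq u u' a : color u = color u' -> holds u a = holds u' a.
Proof. by move=> e; rewrite -!color_holdsE e. Qed.

Lemma color_same u u' : size u = b -> size u' = b -> color u = color u' ->
  same_atoms u u'.
Proof.
move=> su su' e; split=> [|i j|R v]; rewrite su ?su' //.
  by move=> ib jb; exact: (color_holds_eq (inl (Ordinal ib, Ordinal jb)) e).
case/(lift_tuple 'I_b) => v' <-; have /= := color_holds_eq (inr (Tagged _ v')) e.
rewrite (_ : map_tuple (nth d0 u) _ = map_tuple (fun i : 'I_b => nth d0 u i) v').
  rewrite (_ : map_tuple (nth d0 u') _ =
               map_tuple (fun i : 'I_b => nth d0 u' i) v').
    by move=> h; split=> /asboolP; [rewrite h|rewrite -h] => /asboolP.
  by apply: val_inj; rewrite /= -map_comp.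
by apply: val_inj; rewrite /= -map_comp.
Qed.

Hypothesis b1 : 1 < b.
Hypothesis arity_le : forall R : tau, arity R <= b.
Let b0 : 0 < b := ltnW b1.

Lemma lookup_typ xs w : size w = b -> all (fun i => i < size xs) w ->
  lookup (typ xs) w = color (map (nth d0 xs) w).
Proof. exact: lookup_build. Qed.

Lemma size_typ xs ys : typ xs = typ ys -> size xs = size ys.
Proof. exact: size_build. Qed.

Lemma pull_typ xs u : all (fun i => i < size xs) u ->
  pull (typ xs) u = typ (map (nth d0 xs) u).
Proof.
move=> /allP ux; rewrite /pull [RHS]build_map; apply: eq_build => w sw wu.
by rewrite lookup_typ //; apply/allP => i /wu/ux.
Qed.

Lemma nth_pad (T : Type) (x0 y0 : T) l i : i < b -> i < size l ->
  nth x0 (pad b y0 l) i = nth x0 l i.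
Proof.
by move=> ib il; rewrite (nth_map 0) ?size_iota ?nth_iota //;
  apply: set_nth_default.
Qed.

Lemma size_pad (T : Type) (x0 : T) l : size (pad b x0 l) = b.
Proof. by rewrite size_map size_iota. Qed.

Lemma map_pad (S T : Type) (x0 : S) (y0 : T) (f : S -> T) l : 0 < size l ->
  map f (pad b x0 l) = pad b y0 (map f l).
Proof.
case: l => // x l _; rewrite /pad -map_comp; apply: eq_map => i /=.
by rewrite -[f x :: _]/(map f (x :: l)); elim: (x :: l) i => [|y s IHs] [|i] /=.
Qed.

Lemma all_pad (T : Type) (P : pred T) x0 l : (size l == 0) ==> P x0 -> all P l ->
  all P (pad b x0 l).
Proof.
move=> P0 Pl; rewrite all_map; apply/allP => i _ /=.
have Ph : P (head x0 l) by case: l P0 Pl => //= x l _ /andP[].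
by case: (ltnP i (size l)) => [il|li]; [exact: all_nthP | rewrite nth_default].
Qed.

Lemma typ_same xs ys : typ xs = typ ys -> same_atoms xs ys.
Proof.
move=> e; have sxy := size_typ e.
have pick w : size w = b -> all (fun i => i < size xs) w ->
    same_atoms (map (nth d0 xs) w) (map (nth d0 ys) w).
  by move=> sw wx; apply: color_same; rewrite ?size_map // -!lookup_typ -?sxy // e.
split=> // [i j ix jx|R v vx].
  have [] := pick (pad b 0 [:: i; j]); rewrite ?size_pad //.
    by apply: all_pad => //=; rewrite ix jx.
  rewrite size_map size_pad => _ /(_ 0 1 b0 b1) + _.
  by rewrite !(nth_map 0 d0) ?size_pad // !nth_pad.
case: (posnP (size v)) => [v0|v0].
  by rewrite (_ : map_tuple (nth d0 xs) v = map_tuple (nth d0 ys) v) //;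
    apply: val_inj => /=; case: (val v) v0.
have [] := pick (pad b 0 v); rewrite ?size_pad //.
  by apply: all_pad => //=; rewrite (gtn_eqF v0).
rewrite size_map size_pad => _ _ /(_ R [tuple of iota 0 (arity R)]).
have vb i : i < arity R -> i < b by move/leq_trans; apply.
have eqv zs : map_tuple (nth d0 (map (nth d0 zs) (pad b 0 v)))
    [tuple of iota 0 (arity R)] = map_tuple (nth d0 zs) v.
  apply: val_inj; apply: (@eq_from_nth _ d0);
    rewrite /= !size_map size_iota ?size_tuple //.
  move=> i iR; rewrite (nth_map 0) ?size_iota // nth_iota // add0n.
  by rewrite (nth_map 0 d0) ?size_pad ?vb // nth_pad ?vb ?size_tuple //
             (nth_map 0 d0) ?size_tuple.
by rewrite !eqv; apply; apply/allP => i; rewrite mem_iota => /vb.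
Qed.

Lemma iso_color g u : isomorphism Delta Delta g -> size u = b ->
  color (map g u) = color u.
Proof.
move=> [/bij_inj inj hg] su; apply: eq_color => -[[i j]|[R v]] /=.
  by rewrite !(nth_map d0) ?su // inj_eq.
have e : map_tuple (fun i : 'I_b => nth d0 (map g u) i) v =
    map_tuple g (map_tuple (fun i : 'I_b => nth d0 u i) v).
  by apply: val_inj => /=; rewrite -map_comp; apply: eq_map => i /=;
    rewrite (nth_map d0) ?su.
by apply/asboolP/asboolP; rewrite e -hg.
Qed.

Lemma iso_typ g zs : isomorphism Delta Delta g -> typ (map g zs) = typ zs.
Proof.
by move=> hg; rewrite /typ build_map; apply: eq_build => u su _; exact: iso_color.
Qed.

Section Homogeneity.
Hypothesis Delta_hom : homogeneous Delta.

Lemma same_iso xs ys : same_atoms xs ys ->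
  exists2 g, isomorphism Delta Delta g & map g xs = ys.
Proof.
move=> [sxy exy rxy].
pose X := [pred x | x \in xs]; pose Y := [pred y | y \in ys].
have mY (x : {x | X x}) : Y (nth d0 ys (index (sval x) xs)).
  by case: x => x /= xX; rewrite mem_nth // -sxy index_mem.
have mX (y : {y | Y y}) : X (nth d0 xs (index (sval y) ys)).
  by case: y => y /= yY; rewrite mem_nth // sxy index_mem.
pose f x : {y | Y y} := exist (fun y => Y y) _ (mY x).
pose f' y : {x | X x} := exist (fun x => X x) _ (mX y).
have fE i : i < size xs -> nth d0 ys (index (nth d0 xs i) xs) = nth d0 ys i.
  move=> ix; apply/eqP; rewrite -exy ?index_mem ?mem_nth //.
  by rewrite nth_index ?mem_nth.
have f'E i : i < size xs -> nth d0 xs (index (nth d0 ys i) ys) = nth d0 xs i.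
  move=> ix; apply/eqP; rewrite exy ?sxy ?index_mem ?mem_nth -?sxy //.
  by rewrite nth_index ?mem_nth -?sxy.
have iso : isomorphism (induced Delta X) (induced Delta Y) f.
  split.
    exists f' => [[x xX]|[y yY]]; apply: val_inj => /=.
      by rewrite f'E ?index_mem // nth_index.
    by rewrite fE ?sxy ?index_mem // nth_index.
  move=> R t; rewrite /induced.
  pose v := map_tuple (fun x : {x | X x} => index (sval x) xs) t.
  have vx : all (fun i => i < size xs) v.
    by apply/allP => _ /mapP[[x xX] _ ->]; rewrite index_mem.
  have -> : map_tuple sval t = map_tuple (nth d0 xs) v.
    by apply: val_inj; rewrite /= -map_comp; apply: eq_map => -[x xX] /=;
      rewrite nth_index.
  rewrite rxy //; suff -> : map_tuple (nth d0 ys) v =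
    map_tuple sval (map_tuple f t) by [].
  by apply: val_inj; rewrite /= -!map_comp.
have [||g [giso gf]] := Delta_hom _ _ iso; [by exists xs|by exists ys|].
exists g => //; apply: (@eq_from_nth _ d0) => [|i]; rewrite size_map // => ix.
rewrite (nth_map d0) //; have xX : X (nth d0 xs i) by exact: mem_nth.
by rewrite (gf (exist (fun x => X x) _ xX)) /= fE.
Qed.

(** Homogeneity turns equality of types into conjugacy, so types are orbits. *)
Lemma typ_iso xs ys : typ xs = typ ys ->
  exists2 g, isomorphism Delta Delta g & map g xs = ys.
Proof. by move/typ_same/same_iso. Qed.

End Homogeneity.

Definition local_types : seq (tab b) :=
  [seq p <- tabs ncolors b b | `[< exists2 xs, size xs = b & typ xs = p >]].

Lemma typ_tabs xs : typ xs \in tabs ncolors b (size xs).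
Proof. by apply: build_tabs => u _ _; exact: color_lt. Qed.

Lemma realizable_typ xs : realizable local_types (size xs) (typ xs).
Proof.
apply/allP => u; rewrite mem_lists => /andP[/eqP su /allP ux].
have {}ux : all (fun i => i < size xs) u.
  by apply/allP => i /ux; rewrite /= mem_iota.
rewrite pull_typ // mem_filter; apply/andP; split.
  by apply/asboolP; exists (map (nth d0 xs) u); rewrite ?size_map.
by have := typ_tabs (map (nth d0 xs) u); rewrite size_map su.
Qed.

(** A table [q] all of whose restrictions to [b] indices are types describes a
    structure on the indices, up to the equivalence relation of being forced to
    be equal. No forbidden structure embeds into the quotient: its image would
    have fewer than [b] points, thus lie in a part of [q] that is realized in
    [Delta]. So the quotient is in the age, and an embedding into [Delta]
    realizes [q]. *)
Section Locality.
Variables (m : nat) (F : 'I_m -> finStructure tau).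
Hypothesis bounds : forall A,
  age Delta A <-> forall i, ~ embeds (fin_str (F i)) (fin_str A).
Hypothesis bound_lt : forall i, #|F i| < b.
Hypothesis arity2_le : forall R : tau, (arity R).*2 <= b.
Hypothesis b2 : 2 < b.

Section Realize.
Variables (L : nat) (q : tab b).
Hypothesis L0 : 0 < L.
Hypothesis qL : q \in tabs ncolors b L.
Hypothesis q_real : realizable local_types L q.

Definition models (u : seq nat) (zs : seq D) :=
  size zs = size u /\ forall w, size w = b -> all (fun i => i < size u) w ->
    lookup q (map (nth 0 u) w) = color (map (nth d0 zs) w).

(** The properties of [eqv] and [relq] below are read off from models of the
    few indices involved. *)
Lemma exists_model u : 0 < size u <= b -> all (fun i => i < L) u ->
  exists zs, models u zs.
Proof.
move=> /andP[u0 ub] uL; set u' := pad b 0 u.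
have u'L : all (fun i => i < L) u'.
  by apply: all_pad => //; rewrite (gtn_eqF u0).
have : pull q u' \in local_types.
  apply: (allP q_real); rewrite mem_lists size_pad eqxx; apply/allP => i iu.
  by rewrite /= mem_iota (allP u'L).
rewrite mem_filter => /andP[/asboolP[zs szs ezs] _].
have ub' i : i < size u -> i < b by move/leq_trans; apply.
exists (take (size u) zs); split=> [|w sw /allP wu].
  by rewrite size_take szs; case: ltngtP ub.
have wb : all (fun i => i < size zs) w by rewrite szs; apply/allP => i /wu/ub'.
have -> : map (nth d0 (take (size u) zs)) w = map (nth d0 zs) w.
  by apply/eq_in_map => i /wu iu; rewrite nth_take.
rewrite -lookup_typ // ezs (lookup_build 0) ?size_pad //; last by rewrite -szs.
congr lookup.
by apply/eq_in_map => i /wu iu; rewrite nth_pad ?ub'.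
Qed.

Definition eqv (i j : nat) : bool :=
  color_holds (lookup q (pad b 0 [:: i; j])) (inl (Ordinal b0, Ordinal b1)).

Definition relq (R : tau) (v : seq nat) : bool :=
  color_holds (lookup q (pad b 0 v))
    (inr (Tagged (fun R : tau => (arity R).-tuple 'I_b)
      [tuple widen_ord (arity_le R) i | i < arity R])).

Lemma eqv_model u zs i j : models u zs -> i < size u -> j < size u ->
  eqv (nth 0 u i) (nth 0 u j) = (nth d0 zs i == nth d0 zs j).
Proof.
move=> [_ mz] iu ju; rewrite /eqv.
rewrite (_ : pad b 0 _ = map (nth 0 u) (pad b 0 [:: i; j]));
  last exact/esym/map_pad.
rewrite mz ?size_pad //; last by apply: all_pad => //=; rewrite iu ju.
by rewrite color_holdsE /= !(nth_map 0 d0) ?size_pad // !nth_pad.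
Qed.

Lemma holds_first (R : tau) zs v : size v = b ->
  holds (map (nth d0 zs) v) (inr (Tagged (fun R : tau => (arity R).-tuple 'I_b)
      [tuple widen_ord (arity_le R) i | i < arity R])) =
  `[< Delta (map_tuple (nth d0 zs) [tuple nth 0 v i | i < arity R]) >].
Proof.
move=> sv /=; congr asbool; congr (Delta _); apply: eq_from_tnth => i.
rewrite !tnth_map !tnth_ord_tuple (nth_map 0) ?sv //=.
exact: leq_trans (ltn_ord i) (arity_le R).
Qed.

Lemma relq_model u zs R (v : (arity R).-tuple nat) : models u zs ->
  all (fun i => i < size u) v ->
  relq R (map (nth 0 u) v) = `[< Delta (map_tuple (nth d0 zs) v) >].
Proof.
move=> mu vu; case: (posnP (size v)) => v0; last first.
  case: mu => _ mz; rewrite /relq -(map_pad 0) //.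
  rewrite mz ?size_pad //; last by apply: all_pad => //; rewrite (gtn_eqF v0).
  rewrite color_holdsE holds_first ?size_pad //; congr asbool; congr (Delta _).
  apply: eq_from_tnth => i; rewrite !tnth_map tnth_ord_tuple (tnth_nth 0)
    nth_pad //.
    exact: leq_trans (ltn_ord i) (arity_le R).
  by rewrite size_tuple.
have [||z [_ mz]] := @exists_model [:: 0]; rewrite /= ?b0 ?L0 //.
rewrite (size0nil v0); have := mz (pad b 0 [::]); rewrite size_pad => /(_ erefl).
rewrite (_ : map (nth 0 [:: 0]) _ = pad b 0 [::]); last first.
  by rewrite -map_comp; apply: eq_map => i /=; rewrite !nth_nil.
rewrite /relq => ->; last by apply: all_pad.
rewrite color_holdsE holds_first ?size_pad //; congr asbool; congr (Delta _).
apply: val_inj; transitivity ([::] : seq D); last by rewrite /= (size0nil v0).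
by apply: size0nil; rewrite size_tuple -(size_tuple v).
Qed.

Lemma eqv_refl i : i < L -> eqv i i.
Proof.
move=> iL; have [||zs mz] := @exists_model [:: i]; rewrite /= ?b0 ?iL //.
by rewrite (eqv_model (i := 0) (j := 0) mz).
Qed.

Lemma eqv_class i j : i < L -> j < L -> eqv i j ->
  forall k, k < L -> eqv i k = eqv j k.
Proof.
move=> iL jL ij k kL.
have [||zs mz] := @exists_model [:: i; j; k]; rewrite /= ?b2 ?iL ?jL ?kL //.
move: ij; rewrite (eqv_model (i := 0) (j := 1) mz) // => /eqP ij.
by rewrite (eqv_model (i := 0) (j := 2) mz) // ij (eqv_model (i := 1) (j := 2) mz).
Qed.

Definition rep (i : nat) : nat := head 0 [seq j <- iota 0 L | eqv i j].

Lemma repP i : i < L -> rep i < L /\ eqv i (rep i).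
Proof.
move=> iL; have : rep i \in [seq j <- iota 0 L | eqv i j].
  rewrite /rep; have : i \in [seq j <- iota 0 L | eqv i j].
    by rewrite mem_filter eqv_refl // mem_iota.
  by case: [seq _ <- _ | _] => //= j s _; rewrite mem_head.
by rewrite mem_filter mem_iota => /andP[].
Qed.

Lemma rep_eqv i j : i < L -> j < L -> eqv i j = (rep i == rep j).
Proof.
move=> iL jL; apply/idP/eqP => [ij|eij].
  rewrite /rep; congr head; apply: eq_in_filter => k; rewrite mem_iota => kL.
  exact: eqv_class.
have [rL ir] := repP iL; have [_ jr] := repP jL.
rewrite -eij in jr; rewrite (eqv_class iL rL ir) // -(eqv_class jL rL jr) //.
exact: eqv_refl.
Qed.

Lemma rep_id i : i < L -> rep (rep i) = rep i.
Proof. by move=> iL; have [rL] := repP iL; rewrite rep_eqv // => /eqP. Qed.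

Lemma relq_rep R (v : (arity R).-tuple nat) : all (fun i => i < L) v ->
  relq R v = relq R (map rep v).
Proof.
move=> vL; case: (posnP (size v)) => v0; first by rewrite (size0nil v0).
pose u := v ++ map rep v.
have uL : all (fun i => i < L) u.
  rewrite all_cat vL all_map; apply/allP => i iv /=.
  by have [] := repP (allP vL _ iv).
have su : size u = (arity R).*2 by rewrite size_cat size_map size_tuple addnn.
have [|zs mz] := @exists_model u _ uL.
  by rewrite su arity2_le double_gt0 -{1}(size_tuple v) v0.
pose v1 := [tuple of iota 0 (arity R)]; pose v2 := [tuple of iota (arity R)
  (arity R)].
have e1 : map (nth 0 u) v1 = v.
  apply: (@eq_from_nth _ 0) => [|i]; rewrite size_map size_iota ?size_tuple //
    => iR.
  by rewrite (nth_map 0) ?size_iota // nth_iota // nth_cat size_tuple iR.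
have e2 : map (nth 0 u) v2 = map rep v.
  apply: (@eq_from_nth _ 0) => [|i]; rewrite !size_map size_iota ?size_tuple //
    => iR.
  rewrite (nth_map 0) ?size_iota // nth_iota // nth_cat size_tuple.
  by rewrite ltnNge leq_addr /= addKn.
rewrite -{1}e1 -e2 !(relq_model mz); first last.
- by apply/allP => i; rewrite mem_iota su -addnn => /andP[_ /leq_trans]; apply;
    rewrite leq_addr.
- by apply/allP => i; rewrite mem_iota su -addnn => /andP[].
congr asbool; congr (Delta _); apply: eq_from_tnth => i.
rewrite !tnth_map !(tnth_nth 0) !nth_iota //; apply/eqP.
have iR := ltn_ord i; have iv : i < size v by rewrite size_tuple.
rewrite -(eqv_model mz) ?su -?addnn ?ltn_add2l ?add0n //; last first.
  by apply: leq_trans iR _; rewrite leq_addr.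
have nL : nth 0 v i < L by move/(all_nthP 0): (vL); apply.
rewrite !nth_cat size_tuple iR ltnNge leq_addr /= addKn (nth_map 0) //.
by have [] := repP nL.
Qed.

Definition quot := {i : 'I_L | rep i == i}.

Definition quot_str : structure tau quot :=
  fun R t => relq R [seq val (val x) | x <- t].

(** The index [0] is added to the image of a forbidden structure because models
    need a nonempty set of indices. *)
Lemma quot_age : age Delta (FinStructure quot_str).
Proof.
apply/bounds => i0 [f [finj fhom]].
pose u := 0 :: [seq val (val (f x)) | x <- enum (F i0)].
have su : size u = #|F i0|.+1 by rewrite /= size_map -cardE.
have [||zs mz] := @exists_model u.
- by rewrite su /=.
- by rewrite /= L0 all_map; apply/allP => x _ /=.
have fL x : val (val (f x)) < L by exact: ltn_ord.
pose pos (x : F i0) := (enum_rank x).+1.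
have posu x : pos x < size u by rewrite su ltnS ltn_ord.
have nth_pos x : nth 0 u (pos x) = val (val (f x)).
  by rewrite /= (nth_map x) ?nth_enum_rank // -cardE.
have Fage : age Delta (F i0).
  exists (fun x => nth d0 zs (pos x)); split.
    move=> x y /eqP; rewrite -(eqv_model mz) // !nth_pos (rep_eqv (fL _) (fL _)).
    by rewrite (eqP (valP (f x))) (eqP (valP (f y))) => /eqP/ord_inj/val_inj/finj.
  move=> R t; rewrite fhom /= /quot_str.
  have -> : [seq val (val x) | x <- map_tuple f t] =
      map (nth 0 u) (map_tuple pos t).
    by rewrite -!map_comp; apply: eq_map => x; exact/esym/nth_pos.
  rewrite (relq_model mz); last by apply/allP => _ /mapP[x _ ->].
  rewrite (_ : map_tuple (nth d0 zs) _ = map_tuple (fun x => nth d0 zs (pos x)) t).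
    by split=> /asboolP.
  by apply: val_inj; rewrite /= -map_comp.
move/bounds: Fage => /(_ i0); apply; exists id; split=> // R t.
by rewrite (_ : map_tuple id t = t) //; apply: val_inj; rewrite /= map_id.
Qed.

Lemma realize : exists2 xs, size xs = L & typ xs = q.
Proof.
have [h [hinj hhom]] := quot_age.
pose h' n := if [pick a : quot | val (val a) == n] is Some a then h a else d0.
have h'E a : h' (val (val a)) = h a.
  by rewrite /h'; case: pickP => [c /eqP/ord_inj/val_inj->|/(_ a)]; rewrite ?eqxx.
have liftq i : i < L -> exists a : quot, val (val a) = rep i.
  move=> iL; have [rL _] := repP iL.
  by exists (exist _ (Ordinal rL) (introT eqP (rep_id iL))).
exists [seq h' (rep i) | i <- iota 0 L]; first by rewrite size_map size_iota.
rewrite [RHS](tabsE qL) /typ build_map; apply: eq_build => w sw wL.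
have {}wL : all (fun i => i < L) w by apply/allP => i /wL; rewrite mem_iota.
have [|zs mz] := @exists_model w _ wL; first by rewrite sw b0 /=.
have [szs czs] := mz.
have nz : map (nth d0 zs) (iota 0 b) = zs by rewrite -sw -szs map_nth_iota0
  ?take_size.
have nw : map (nth 0 w) (iota 0 b) = w by rewrite -sw map_nth_iota0 ?take_size.
have wi i : i < b -> nth 0 w i < L by rewrite -sw; move/(all_nthP 0): (wL); apply.
have := czs (iota 0 b); rewrite size_iota nz nw => -> //; last first.
  by apply/allP => i; rewrite mem_iota sw.
apply: eq_color => -[[i j]|[R v]] /=.
  rewrite -(eqv_model mz) ?sw // rep_eqv ?wi //.
  rewrite !(nth_map 0) ?sw //.
  have [a ea] := liftq _ (wi i (ltn_ord i)).
  have [c ec] := liftq _ (wi j (ltn_ord j)).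
  rewrite -ea -ec !h'E (inj_eq hinj); apply/eqP/eqP => [->//|].
  by move/ord_inj/val_inj.
pose v' := map_tuple val v; pose wv := map_tuple (nth 0 w) v'.
have v'b : all (fun i => i < size w) v'.
  by rewrite sw; apply/allP => _ /mapP[x _ ->] /=.
have wvL : all (fun i => i < L) wv.
  by apply/allP => _ /mapP[_ /mapP[x _ ->] ->]; apply: wi; exact: ltn_ord.
transitivity (relq R wv); last first.
  rewrite (relq_model mz) //; congr asbool; congr (Delta _).
  by apply: val_inj; rewrite /= -map_comp.
rewrite relq_rep //.
have [t et] : exists t : (arity R).-tuple quot,
    [seq val (val x) | x <- t] = map rep wv.
  have ch i : exists a : quot, val (val a) = rep (tnth wv i).
    by apply: liftq; have /all_tnthP := wvL.
  have [s sE] := choice ch.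
  exists [tuple s i | i < arity R]; apply: (@eq_from_nth _ 0).
    by rewrite size_map size_tuple size_map size_tuple.
  move=> i; rewrite size_map size_tuple => iR.
  pose o := Ordinal iR.
  have -> : i = o by [].
  rewrite (nth_map (s o)) ?size_tuple // -tnth_nth tnth_mktuple sE.
  by rewrite (nth_map 0) ?size_tuple // -tnth_nth.
have -> : relq R (map rep wv) = `[< quot_str t >].
  by rewrite -et; apply/idP/asboolP.
have -> : `[< quot_str t >] = `[< Delta (map_tuple h t) >].
  by apply/asboolP/asboolP => /hhom.
congr asbool; congr (Delta _); apply: val_inj => /=.
transitivity (map h' [seq val (val x) | x <- t]).
  rewrite et -!map_comp; apply: eq_map => i /=.
  by rewrite (nth_map 0) ?sw.
by rewrite -map_comp; apply: eq_map => a /=; rewrite h'E.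
Qed.

End Realize.

Lemma realizableP L (q : tab b) : q \in tabs ncolors b L ->
  realizable local_types L q -> exists2 xs, size xs = L & typ xs = q.
Proof.
case: L => [|L] qL qr; last exact: realize qL qr.
exists [::] => //; rewrite [RHS](tabsE qL) /typ.
by move: color (lookup q) => g g'; case: (b) b0.
Qed.

End Locality.
End Types.

(** * Relations of a reduct *)

Lemma sat_iso (sg : signature) (D : Type) (A : structure sg D) g phi e :
  isomorphism A A g -> sat A (g \o e) phi <-> sat A e phi.
Proof.
move=> [[g' gK g'K] hom]; have inj := can_inj gK.
have upd (f : nat -> D) i d :
    ([eta g \o f with i |-> g d] : nat -> D) = g \o [eta f with i |-> d].
  by apply: funext => x /=; case: eqP.
elim: phi e => [i j|R v|p IHp|p IHp q IHq|p IHp q IHq|i p IHp|i p IHp] e /=.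
- by split=> [/inj//|->].
- have -> : map_tuple (g \o e) v = map_tuple g (map_tuple e v).
    by apply: val_inj; rewrite /= map_comp.
  by symmetry; exact: hom.
- by rewrite IHp.
- by rewrite IHp IHq.
- by rewrite IHp IHq.
- split=> -[d hd]; last by exists (g d); rewrite upd IHp.
  by exists (g' d); rewrite -IHp -upd g'K.
- split=> hd d; first by rewrite -IHp -upd; apply: hd.
  by rewrite -[d]g'K upd IHp; apply: hd.
Qed.

Lemma env_nth (A : eqType) (a0 : A) n (vars : n.-tuple nat) (t : n.-tuple A) :
  uniq vars -> map_tuple (env a0 vars t) vars = t.
Proof.
move=> uv; apply: val_inj; apply: (@eq_from_nth _ a0) => [|i].
  by rewrite size_map !size_tuple.
rewrite size_map => iv; rewrite /= (nth_map 0) // /env index_uniq //.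
Qed.

Lemma reduct_iso (sg tau : signature) (D : eqType) (d0 : D)
    (G : structure sg D) (A : structure tau D) g R t :
  reduct G A -> isomorphism A A g -> G R (map_tuple g t) <-> G R t.
Proof.
move=> red giso; have [xs [phi [uxs _ def]]] := red R.
have et := env_nth d0 t uxs.
have -> : map_tuple g t = map_tuple (g \o env d0 xs t) xs.
  by apply: val_inj; rewrite /= map_comp -[in LHS]et.
by rewrite def (sat_iso phi _ giso) -def et.
Qed.

Lemma sat_qf_ext (sg : signature) (D : Type) (A : structure sg D) e e' phi :
  quantifier_free phi -> {in free_vars phi, e =1 e'} ->
  sat A e phi <-> sat A e' phi.
Proof.
elim: phi => [i j|R v|p IHp|p IHp q IHq|p IHp q IHq|i p IHp|i p IHp] //=.
- by move=> _ ee; rewrite !ee ?inE ?eqxx ?orbT.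
- move=> _ ee; rewrite (_ : map_tuple e v = map_tuple e' v) //.
  by apply: val_inj => /=; apply/eq_in_map.
- by move=> qp ee; rewrite IHp.
- move=> /andP[qp qq] ee; rewrite IHp ?IHq // => x xp; apply: ee;
    by rewrite mem_cat xp ?orbT.
- move=> /andP[qp qq] ee; rewrite IHp ?IHq // => x xp; apply: ee;
    by rewrite mem_cat xp ?orbT.
Qed.

Section Reduct.
Variables (tau sg : signature) (D : countType) (Delta : structure tau D).
Variables (Gamma : structure sg D) (d0 : D) (b : nat).
Hypothesis b1 : 1 < b.
Hypothesis arity_le : forall R : tau, arity R <= b.
Hypothesis arity_sg : forall R : sg, arity R <= b.
Hypothesis Delta_hom : homogeneous Delta.
Hypothesis Gamma_red : reduct Gamma Delta.
Let b0 : 0 < b := ltnW b1.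

Local Notation color := (color Delta d0 b).
Local Notation typ := (typ Delta d0 b).
Local Notation N := (ncolors tau b).

Definition eq_colors : seq nat :=
  [seq c <- iota 0 N | `[< exists u : seq D,
    [/\ size u = b, nth d0 u 0 = nth d0 u 1 & color u = c] >]].

Definition rel_colors (R : sg) : seq nat :=
  [seq c <- iota 0 N | `[< exists (x : (arity R).-tuple D) (u : seq D),
    [/\ size u = b, take (arity R) u = x, Gamma x & color u = c] >]].

Definition sg_colors : seq (seq nat) := [seq rel_colors R | R <- enum sg].

Lemma mem_eq_colors u : size u = b ->
  (color u \in eq_colors) = (nth d0 u 0 == nth d0 u 1).
Proof.
move=> su; rewrite mem_filter mem_iota leq0n color_lt !andbT.
apply/idP/eqP => [/asboolP[u' [su' e c]]|e]; last by apply/asboolP; exists u.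
have [_ /(_ 0 1) eqs _] := color_same su' su c.
by apply/eqP; rewrite -eqs ?su' // e.
Qed.

(** Automorphisms preserve the relations of a reduct, and tuples of the same
    colour are conjugate; so the colour decides membership. *)
Lemma mem_rel_colors R (x : (arity R).-tuple D) u : size u = b ->
  take (arity R) u = x -> (color u \in rel_colors R) <-> Gamma x.
Proof.
move=> su ux; rewrite mem_filter mem_iota leq0n color_lt !andbT.
split=> [/asboolP[x' [u' [su' ux' gx' c]]]|gx]; last by apply/asboolP; exists x, u.
have [g giso gu] := same_iso Delta_hom (color_same su' su c).
rewrite (_ : x = map_tuple g x'); last first.
  by apply: val_inj; rewrite /= -ux -ux' map_take gu.
by rewrite (reduct_iso d0 _ Gamma_red giso).
Qed.

Lemma evalf_sat (xs : seq D) (e : nat -> nat) (phi : formula sg) :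
  0 < size xs -> quantifier_free phi ->
  {in free_vars phi, forall x, e x < size xs} ->
  evalf eq_colors sg_colors (typ xs) e phi <->
  sat Gamma (fun x => nth d0 xs (e x)) phi.
Proof.
move=> xs0; elim: phi => [i j|R v|p IHp|p IHp q IHq|p IHp q IHq|i p IHp|i p IHp]
  //=.
- move=> _ he; have ij : all (fun i => i < size xs) [:: e i; e j].
    by rewrite /= !he ?inE ?eqxx ?orbT.
  rewrite /atom lookup_typ ?size_pad //; last exact: all_pad.
  rewrite mem_eq_colors ?size_map ?size_iota //.
  rewrite !(nth_map 0 d0) ?size_pad // !nth_pad //=.
  by split=> /eqP.
- move=> _ he; have vx : all (fun i => i < size xs) (map e v).
    by apply/allP => _ /mapP[x xv ->]; apply: he.
  rewrite /atom lookup_typ ?size_pad //; last first.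
    by apply: all_pad => //; rewrite xs0 implybT.
  rewrite (nth_map R) ?nth_enum_rank -?cardE ?ltn_ord //.
  apply: mem_rel_colors; first by rewrite !size_map size_iota.
  apply: (@eq_from_nth _ d0); first by rewrite size_takel !size_map ?size_iota
    ?size_tuple.
  rewrite size_takel ?size_map ?size_iota // => i iR.
  have ib := leq_trans iR (arity_sg R).
  rewrite nth_take // (nth_map 0 d0) ?size_pad // nth_pad ?size_map ?size_tuple //.
  by rewrite !(nth_map 0) ?size_tuple.
- by move=> qp he; rewrite -IHp //; split=> /negP.
- move=> /andP[qp qq] he; rewrite -IHp -?IHq //; try by split=> /andP.
    by move=> x xq; apply: he; rewrite mem_cat xq orbT.
  by move=> x xp; apply: he; rewrite mem_cat xp.
- move=> /andP[qp qq] he; rewrite -IHp -?IHq //; try by split=> /orP.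
    by move=> x xq; apply: he; rewrite mem_cat xq orbT.
  by move=> x xp; apply: he; rewrite mem_cat xp.
Qed.

(** The relation defined by [d], as a predicate on lists of any length; only
    the first [size (qf_vars d)] entries matter. *)
Definition qf_holds (d : qf_def sg) (xs : seq D) : Prop :=
  sat Gamma (env d0 (qf_vars d) xs) (qf_form d).

Lemma qf_relE d t : wf_qf_def d -> qf_rel Gamma d t <-> qf_holds d t.
Proof.
case/and3P=> qf uv /allP fv; split=> [[e [<- se]]|h].
  apply: (iffLR (sat_qf_ext Gamma qf _)) se => x /fv xv.
  by rewrite /env (nth_map 0) ?index_mem // nth_index.
by exists (env d0 (qf_vars d) t); split; first exact: env_nth.
Qed.

Lemma evald_holds d (xs : seq D) idx : wf_qf_def d -> 0 < size xs ->
  size (qf_vars d) <= size idx -> all (fun i => i < size xs) idx ->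
  evald eq_colors sg_colors d (typ xs) idx <-> qf_holds d (map (nth d0 xs) idx).
Proof.
case/and3P=> qf uv /allP fv xs0 sd /(all_nthP 0) ix.
have ixd x : x \in free_vars (qf_form d) -> index x (qf_vars d) < size idx.
  by move/fv => xv; apply: leq_trans sd; rewrite index_mem.
rewrite /evald evalf_sat //; last by move=> x /ixd/ix.
by apply: sat_qf_ext => // x /ixd xv; rewrite /env (nth_map 0).
Qed.

Lemma qf_holds_take d xs ys : wf_qf_def d -> size (qf_vars d) <= size xs ->
  qf_holds d (xs ++ ys) <-> qf_holds d xs.
Proof.
case/and3P=> qf uv /allP fv sx; apply: sat_qf_ext => // x /fv xv.
by rewrite /env nth_cat (leq_trans _ sx) ?index_mem.
Qed.

End Reduct.

(** * The Ramsey property for lists *)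

Lemma count_lt (T : eqType) (a b : pred T) (s : seq T) x :
  (forall z, a z -> b z) -> x \in s -> b x -> ~~ a x -> count a s < count b s.
Proof.
move=> ab xs bx ax; have le := sub_count ab.
elim: s xs => //= y s IHs; rewrite inE => /predU1P[<-|xs].
  by rewrite bx (negPf ax) ltnS; apply: le.
by rewrite -addnS leq_add ?IHs //; case: (a y) (ab y) => // ->.
Qed.

Section Ramsey.
Variables (tau : signature) (D : countType) (Delta : structure tau D).
Variables (d0 : D) (b : nat).
Hypothesis b1 : 1 < b.
Hypothesis arity_le : forall R : tau, arity R <= b.
Hypothesis Delta_hom : homogeneous Delta.
Hypothesis Delta_ordered : ordered (age Delta).
Hypothesis Delta_ramsey : ramsey (age Delta).

Local Notation typ := (typ Delta d0 b).

Definition fin_sub (xs : seq D) : finStructure tau :=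
  @FinStructure tau (seq_sub xs) (fun R t => Delta (map_tuple val t)).

Lemma age_fin_sub xs : age Delta (fin_sub xs).
Proof. by exists val; split; first exact: val_inj. Qed.

(** The order is only given on finite substructures; passing to its strict
    version removes the difference between the two conventions. *)
Lemma strict_order : exists lt : rel D,
  [/\ transitive lt, irreflexive lt, forall x y, x != y -> lt x y || lt y x
    & forall g, isomorphism Delta Delta g -> forall x y, lt (g x) (g y) = lt x y].
Proof.
have [R [ar2 ord]] := Delta_ordered.
have tcast_map (A B : Type) (f : A -> B) x y :
    map_tuple f (tcast ar2 [tuple x; y]) = tcast ar2 [tuple f x; f y].
  by clear ord; case: _ / ar2; apply: val_inj.
pose r x y := Delta (tcast ar2 [tuple x; y]).
have tot3 x y z : [/\ r x y -> r y z -> r x z, r x y -> r y x -> x = y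
    & x <> y -> r x y \/ r y x].
  pose l := [:: x; y; z].
  have xl : x \in l by rewrite mem_head.
  have yl : y \in l by rewrite !inE eqxx orbT.
  have zl : z \in l by rewrite !inE eqxx !orbT.
  have [tr anti total _] := ord _ (age_fin_sub l).
  have rE u v (ul : u \in l) (vl : v \in l) :
      r u v = fin_str (fin_sub l) R (tcast ar2 [tuple SeqSub ul; SeqSub vl]).
    by rewrite /= tcast_map.
  rewrite (rE _ _ xl yl) (rE _ _ yl zl) (rE _ _ xl zl) (rE _ _ yl xl).
  split=> [|h h'|xy]; first exact: tr.
    by have /(congr1 val) := anti _ _ h h'.
  by apply: total => /(congr1 val).
exists (fun x y => (x != y) && `[< r x y >]); split.
- move=> y x z /andP[/eqP xy /asboolP rxy] /andP[/eqP yz /asboolP ryz].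
  have [tr _ _] := tot3 x y z; apply/andP; split; last exact/asboolP/tr.
  apply/eqP => xz; have [_ anti _] := tot3 x y x.
  by apply: xy; apply: anti; rewrite // xz.
- by move=> x; rewrite eqxx.
- move=> x y xy; have [_ _ total] := tot3 x y x.
  rewrite xy eq_sym xy /=.
  by case: (total (elimN eqP xy)) => h; apply/orP; [left|right]; apply/asboolP.
- move=> g [/bij_inj inj hom] x y; rewrite inj_eq //; congr (_ && _).
  by apply/asboolP/asboolP; rewrite /r -tcast_map -hom.
Qed.

(** Automorphisms preserve the order, hence the rank of an element in a finite
    invariant set; so they fix such a set pointwise. *)
Lemma typ_rigid Y Y' : typ Y = typ Y' -> Y =i Y' -> Y = Y'.
Proof.
have [lt [tr irr total giso]] := strict_order.
move=> /(typ_iso b1 arity_le Delta_hom)[g gi gY] eYY.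
pose rank E x := count (fun z => lt z x) E.
have rank_lt x y : x \in Y -> lt x y -> rank (undup Y) x < rank (undup Y) y.
  move=> xY xy; apply: (@count_lt _ _ _ _ x) => [z zx||//|]; last by rewrite irr.
    exact: tr zx xy.
  by rewrite mem_undup.
have gY_in x : x \in Y -> g x \in Y by move=> xY; rewrite eYY -gY map_f.
have rank_g x : rank (undup Y) (g x) = rank (undup Y) x.
  have inj : injective g by case: gi => /bij_inj.
  have /permP pe : perm_eq (undup Y) (map g (undup Y)).
    apply: uniq_perm; rewrite ?map_inj_uniq ?undup_uniq // => z.
    rewrite mem_undup eYY -gY; apply/mapP/mapP => -[w wY ->]; exists w => //.
      by rewrite mem_undup.
    by rewrite -mem_undup.
  by rewrite /rank pe count_map; apply: eq_count => z /=; rewrite giso.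
rewrite -gY -[LHS]map_id; apply/eq_in_map => x xY; apply/eqP/negPn/negP => ne.
by case/orP: (total _ _ ne) => h;
  [have := rank_lt _ _ xY h|have := rank_lt _ _ (gY_in _ xY) h];
  rewrite rank_g ltnn.
Qed.

(** By rigidity a copy of [Xs] is enumerated by only one list of the type of
    [Xs], so one may colour such lists instead of copies. *)
Lemma ramsey_lists k (Hs Xs : seq D) : 0 < k ->
  exists S : seq D, forall col : seq D -> 'I_k,
  exists Hs', [/\ typ Hs' = typ Hs, {subset Hs' <= S}
    & exists c, forall Y, {subset Y <= Hs'} -> typ Y = typ Xs -> col Y = c].
Proof.
move=> k0; have [S [[s [s_inj s_hom]] mono]] :=
  Delta_ramsey k0 (age_fin_sub Hs) (age_fin_sub Xs).
exists (map s (enum S)) => col.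
have ex_chi (X : {set S}) : exists c, forall Y,
    typ Y = typ Xs -> Y =i [seq s x | x in X] -> c = col Y.
  case: (pselect (exists Y, typ Y = typ Xs /\ Y =i [seq s x | x in X])).
    case=> Y [tY eY]; exists (col Y) => Z tZ eZ; congr col.
    by apply: typ_rigid => [|x]; rewrite ?tY ?tZ // eY eZ.
  by move=> no; exists (Ordinal k0) => Y tY eY; case: no; exists Y.
have [chi chiE] := choice ex_chi.
have [Yc [[f [[f' fK f'K] f_hom]] [c cE]]] := mono chi.
pose F x := if insub x is Some h then s (sval (f h)) else d0.
have FE (h : seq_sub Hs) : F (val h) = s (sval (f h)) by rewrite /F valK.
have Fin x : x \in Hs -> exists h : seq_sub Hs, x = val h.
  by move=> xH; exists (SeqSub xH).
have [g giso gH] : exists2 g, isomorphism Delta Delta g & map g Hs = map F Hs.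
  apply: (same_iso Delta_hom (d0 := d0)); split; first by rewrite size_map.
    move=> i j iH jH; rewrite !(nth_map d0) //.
    have [h eh] := Fin _ (mem_nth d0 iH); have [h' eh'] := Fin _ (mem_nth d0 jH).
    rewrite eh eh' !FE (inj_eq s_inj); apply/eqP/eqP => [/val_inj->//|].
    by move/val_inj/(can_inj fK)->.
  move=> R v vH.
  have : all (fun x => x \in Hs) (map_tuple (nth d0 Hs) v).
    by apply/allP => _ /mapP[i iv ->]; apply: mem_nth; exact: (allP vH).
  case/(lift_tuple (seq_sub Hs)) => t et.
  have -> : map_tuple (nth d0 (map F Hs)) v =
    map_tuple s (map_tuple sval (map_tuple f t)).
    apply: val_inj; rewrite /= -!map_comp -[LHS]/(map (nth d0 (map F Hs)) v).
    transitivity (map F (map_tuple (nth d0 Hs) v)).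
      by rewrite /= -map_comp; apply/eq_in_map => i iv /=;
        rewrite (nth_map d0) // (allP vH).
    by rewrite -et /= -map_comp; apply: eq_map => h /=; rewrite FE.
  rewrite -et; apply: iff_trans (f_hom R t) _; exact: s_hom.
exists (map F Hs); split; first by rewrite -gH; exact: iso_typ.
  move=> _ /mapP[x /Fin[h ->] ->]; rewrite FE; apply: map_f.
  by rewrite mem_enum.
exists c => Y YH tY; pose X := [set x | s x \in Y].
have sY y : y \in Y -> exists2 x, x \in Yc & y = s x.
  move/YH => /mapP[z /Fin[h ->] ->]; exists (sval (f h)); last exact: FE.
  exact: (svalP (f h)).
have <- : chi X = col Y.
  apply: chiE => // y; apply/idP/imageP => [yY|[x]]; last by rewrite inE => xY ->.
  by have [x _ yx] := sY _ yY; exists x; rewrite // inE -yx.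
apply: cE.
  apply/subsetP => x; rewrite inE => /sY[x' x'Y /s_inj->] //.
have [e eiso eX] := typ_iso b1 arity_le Delta_hom (esym tY).
have inY (p : seq_sub Xs) : e (val p) \in Y by rewrite -eX map_f ?(valP p).
have ex_phi (p : seq_sub Xs) : exists x : S, s x = e (val p).
  by have [x _ ->] := sY _ (inY p); exists x.
have [phi phiE] := choice ex_phi.
have phiX p : phi p \in X by rewrite inE phiE.
have ex_psi (x : {x | x \in X}) : exists p : seq_sub Xs, e (val p) = s (sval x).
  by case: x => x /=; rewrite inE -eX => /mapP[y yX ->]; exists (SeqSub yX).
have [psi psiE] := choice ex_psi.
have e_inj : injective e by case: eiso => /bij_inj.
exists (fun p => exist (fun x => x \in X) (phi p) (phiX p)); split.
  exists psi => [p|x].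
    by apply: val_inj; apply: e_inj; rewrite psiE /= phiE.
  by apply: val_inj; apply: s_inj; rewrite /= phiE psiE.
move=> R t; have [_ e_hom] := eiso.
apply: iff_trans (e_hom R _) _; apply: iff_sym.
rewrite /induced (_ : map_tuple e _ = map_tuple s (map_tuple phi t)).
  rewrite (_ : map_tuple sval _ = map_tuple phi t); first exact: s_hom.
  by apply: val_inj; rewrite /= -map_comp.
by apply: val_inj; rewrite /= -!map_comp; apply: eq_map => p /=; rewrite phiE.
Qed.

End Ramsey.

(** * Definability and partial polymorphisms *)

Section Points.
Variables (T : eqType) (x0 : T) (m : nat).
Implicit Types (zs us : seq (seq T)).

Definition width zs : bool := all (fun z => size z == m) zs.

Definition coord (j : nat) zs : seq T := [seq nth x0 z j | z <- zs].

Lemma width_cat zs us : width (zs ++ us) = width zs && width us.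
Proof. exact: all_cat. Qed.

Lemma width_sub zs us : {subset us <= zs} -> width zs -> width us.
Proof. by move=> sub /allP zw; apply/allP => z /sub/zw. Qed.

Lemma width_shape zs : width zs -> shape zs = nseq (size zs) m.
Proof. by elim: zs => //= z zs IHzs /andP[/eqP-> /IHzs->]. Qed.

Lemma size_flatten_width zs : width zs -> size (flatten zs) = size zs * m.
Proof. by move=> zw; rewrite size_flatten width_shape // sumn_nseq mulnC. Qed.

Lemma flatten_width_inj zs us : width zs -> width us -> size zs = size us ->
  flatten zs = flatten us -> zs = us.
Proof.
by move=> zw uw s e; apply: eq_from_flatten_shape => //; rewrite !width_shape ?s.
Qed.

Lemma nth_flatten_width zs i j : width zs -> i < size zs -> j < m ->
  nth x0 (flatten zs) (i * m + j) = nth x0 (nth [::] zs i) j.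
Proof.
elim: zs i => //= z zs IHzs [|i] /andP[/eqP sz zw] iz jm; rewrite nth_cat sz.
  by rewrite add0n jm.
by rewrite mulSn -addnA ltnNge leq_addr /= addKn IHzs.
Qed.

Lemma point_lt zs i : width zs -> i < size zs ->
  all (fun x => x < size (flatten zs)) (point m i).
Proof.
move=> zw iz; rewrite size_flatten_width //; apply/allP => _ /mapP[j + ->].
rewrite mem_iota => jm; apply: leq_trans (_ : i.+1 * m <= _).
  by rewrite mulSn addnC ltn_add2r.
by rewrite leq_mul2r iz orbT.
Qed.

Lemma map_point zs i : width zs -> i < size zs ->
  map (nth x0 (flatten zs)) (point m i) = nth [::] zs i.
Proof.
move=> zw iz; have zi : size (nth [::] zs i) = m.
  by apply/eqP; move/(all_nthP [::]): zw; apply.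
apply: (@eq_from_nth _ x0) => [|j]; rewrite !size_map size_iota ?zi // => jm.
rewrite (nth_map 0) ?size_map ?size_iota // (nth_map 0) ?size_iota // nth_iota //.
by rewrite nth_flatten_width.
Qed.

Lemma column_lt zs j k s : width zs -> k + s <= size zs -> j < m ->
  all (fun x => x < size (flatten zs)) (column m j k s).
Proof.
move=> zw ks jm; apply/allP => _ /mapP[i + ->]; rewrite mem_iota => /andP[_ iks].
have /allP := point_lt zw (leq_trans iks ks); apply.
by apply: map_f; rewrite mem_iota.
Qed.

Lemma map_column zs j k s : width zs -> k + s <= size zs -> j < m ->
  map (nth x0 (flatten zs)) (column m j k s) = coord j (take s (drop k zs)).
Proof.
move=> zw ks jm.
have sz : size (take s (drop k zs)) = s.
  by rewrite size_takel // size_drop leq_subRL // (leq_trans _ ks) ?leq_addr.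
apply: (@eq_from_nth _ x0) => [|i]; rewrite !size_map size_iota ?sz // => si.
rewrite (nth_map 0) ?size_map ?size_iota // (nth_map 0) ?size_iota // nth_iota //.
rewrite nth_flatten_width // ?(leq_trans _ ks) ?ltn_add2l //.
by rewrite (nth_map [::]) ?sz // nth_take // nth_drop.
Qed.

Definition rows_of (k : nat) (cs : seq T) : seq (seq T) := reshape (nseq k m) cs.

Lemma rows_ofP k cs : size cs = k * m ->
  [/\ width (rows_of k cs), size (rows_of k cs) = k & flatten (rows_of k cs) = cs].
Proof.
move=> scs; have sh : shape (rows_of k cs) = nseq k m.
  by rewrite reshapeKl // sumn_nseq scs mulnC.
split; last by rewrite reshapeKr // sumn_nseq scs mulnC.
  by rewrite /width -(all_map size (pred1 m)) -/(shape _) sh all_nseq /= eqxx orbT.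
by rewrite -(size_map size) -/(shape _) sh size_nseq.
Qed.

End Points.

Lemma coord_map (S T : eqType) (x0 : S) (y0 : T) m (g : S -> T) j zs :
  width m zs -> j < m -> coord y0 j (map (map g) zs) = map g (coord x0 j zs).
Proof.
move=> /allP zw jm; rewrite /coord -!map_comp; apply/eq_in_map => z /zw/eqP sz /=.
by rewrite (nth_map x0) ?sz.
Qed.

Lemma width_map (S T : eqType) m (g : S -> T) zs :
  width m (map (map g) zs) = width m zs.
Proof. by rewrite /width all_map; apply: eq_all => z /=; rewrite size_map. Qed.

Section Formulas.
Variables (sg : signature) (D : Type) (A : structure sg D).

Definition exists_vars (vs : seq nat) (p : formula sg) : formula sg :=
  foldr (@fEx sg) p vs.

Definition conj_all (v : nat) (ps : seq (formula sg)) : formula sg :=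
  foldr (@fAnd sg) (fEq v v) ps.

Lemma sat_exists_vars vs p e : sat A e (exists_vars vs p) <->
  exists2 e', (forall x, x \notin vs -> e' x = e x) & sat A e' p.
Proof.
elim: vs e => [|v vs IHvs] e /=.
  split=> [h|[e' ee' h]]; first by exists e.
  by rewrite (_ : e = e') //; apply: funext => x; rewrite ee'.
split=> [[d /IHvs[e' ee' h]]|[e' ee' h]].
  exists e' => // x; rewrite inE negb_or => /andP[xv /ee'->] /=.
  by rewrite (negPf xv).
exists (e' v); apply/IHvs; exists e' => // x xvs /=.
by case: eqP => [->//|/eqP xv]; rewrite ee' // inE negb_or xv.
Qed.

Lemma free_vars_exists_vars vs p :
  free_vars (exists_vars vs p) =i [seq x <- free_vars p | x \notin vs].
Proof.
elim: vs => [|v vs IHvs] x /=; first by rewrite mem_filter.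
by rewrite mem_filter IHvs !mem_filter inE negb_or andbA.
Qed.

Lemma pp_exists_vars vs p : conj_of_atoms p ->
  primitive_positive (exists_vars vs p).
Proof. by elim: vs => //=; case: p. Qed.

Lemma sat_conj_all (I : eqType) v (F : I -> formula sg) (l : seq I) e :
  sat A e (conj_all v (map F l)) <-> forall i, i \in l -> sat A e (F i).
Proof.
elim: l => [|i l IHl] //=; rewrite IHl; split=> [[hi hl] j|h].
  by rewrite inE => /predU1P[->//|/hl].
by split=> [|j jl]; apply: h; rewrite ?mem_head // inE jl orbT.
Qed.

Lemma atoms_conj_all v ps : all (@conj_of_atoms sg) ps ->
  conj_of_atoms (conj_all v ps).
Proof. by elim: ps => //= p ps IHps /andP[-> /IHps]. Qed.

Lemma free_vars_conj_all (P : pred nat) v ps : P v ->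
  all (fun p => all P (free_vars p)) ps -> all P (free_vars (conj_all v ps)).
Proof.
move=> Pv; elim: ps => [|p ps IHps] /=; first by rewrite Pv.
by case/andP=> pp /IHps; rewrite all_cat pp.
Qed.

End Formulas.

Section PrimitivePositive.
Variables (sg : signature) (D : countType) (Gamma : structure sg D) (d0 : D).
Variables (r0 : qf_def sg) (rs : seq (qf_def sg)).
Hypothesis wf : all (@wf_qf_def sg) (r0 :: rs).

Local Notation holds := (qf_holds Gamma d0).
Local Notation rel i := (tnth (in_tuple rs) i).
Local Notation defs := (defs_str Gamma rs).

(** [h] behaves on the finite set [F] of points of [D^m] like an [m]-ary
    polymorphism of the relations [rs]. *)
Definition preserves (m : nat) (F : seq (seq D)) (h : seq D -> D) :=
  forall (i : 'I_(size rs)) us, {subset us <= F} ->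
    size us = size (qf_vars (rel i)) ->
    (forall j, j < m -> holds (rel i) (coord d0 j us)) -> holds (rel i) (map h us).

(** The local form of: some polymorphism of [rs] maps [rows] outside [r0]. *)
Definition violates (m : nat) (rows : seq (seq D)) :=
  forall F, width m F ->
    exists2 h, preserves m F h & ~ holds r0 (map h rows).

Lemma wf_r0 : wf_qf_def r0. Proof. by case/andP: wf. Qed.

Lemma wf_rs (i : 'I_(size rs)) : wf_qf_def (rel i).
Proof. by case/andP: wf => _ /(all_tnthP (t := in_tuple rs)). Qed.

Lemma defsE (i : 'I_(size rs)) t : defs i t <-> holds (rel i) t.
Proof. exact: (qf_relE _ _ _ (wf_rs i)). Qed.

(** A primitive positive formula only inspects finitely many points, namely the
    values and witnesses of its variables. *)
Lemma pp_transfer m (psi : formula (defs_sig rs)) (e : nat -> seq D) :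
  primitive_positive psi -> (forall x, size (e x) = m) ->
  (forall j, j < m -> sat defs (fun x => nth d0 (e x) j) psi) ->
  exists2 F, width m F &
    forall h, preserves m F h -> sat defs (fun x => h (e x)) psi.
Proof.
have ppc p : conj_of_atoms p -> @primitive_positive (defs_sig rs) p by case: p.
elim: psi e => [x y|i v|p _|p IHp q IHq|p _ q _|x p IHp|x p _] e //= pp se hj.
- exists [::] => // h _; congr h; apply: (@eq_from_nth _ d0); rewrite ?se //.
- exists (map e v) => [|h hF].
    by apply/allP => _ /mapP[x _ ->]; rewrite se.
  apply/defsE; rewrite (_ : map_tuple _ v = map h (map e v) :> seq D); last first.
    by rewrite /= -map_comp.
  apply: hF; rewrite // ?size_map ?size_tuple // => j jm.
  by have /defsE := hj j jm; rewrite /coord /= -map_comp.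
- case/andP: pp => /ppc pp /ppc qq.
  have [|F Fm hF] := IHp e pp se; first by move=> j /hj[].
  have [|G Gm hG] := IHq e qq se; first by move=> j /hj[].
  exists (F ++ G); first by rewrite width_cat Fm.
  move=> h hFG; split; [apply: hF|apply: hG] => k us usF; apply: hFG => // z.
    by move/usF; rewrite mem_cat => ->.
  by move/usF; rewrite mem_cat => ->; rewrite orbT.
have ex_d (j : nat) : exists d, j < m ->
    sat defs [eta (fun y => nth d0 (e y) j) with x |-> d] p.
  case: (boolP (j < m)) => [/hj[d hd]|_]; first by exists d.
  by exists d0.
have [w hw] := choice ex_d.
pose z := mkseq w m.
have [||F Fm hF] := IHp (fun y => if y == x then z else e y) pp.
- by move=> y; case: eqP => // _; rewrite size_mkseq.
- move=> j jm; have := hw j jm; congr (sat defs _ p).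
  by apply: funext => y /=; case: eqP => // _; rewrite nth_mkseq.
exists F => // h /hF hp; exists (h z); move: hp; congr (sat defs _ p).
by apply: funext => y /=; case: eqP.
Qed.

(** Suppose that a formula defines [r0], and evaluate it at each coordinate of
    the rows. The witnesses of these evaluations form points of [D^m], and a
    partial polymorphism on them makes the formula true at the image of the
    rows, which therefore satisfies [r0]. *)
Lemma violates_not_pp m (rows : seq (seq D)) :
  width m rows -> size rows = size (qf_vars r0) ->
  (forall j, j < m -> holds r0 (coord d0 j rows)) ->
  violates m rows -> ~ pp_expressible Gamma r0 rs.
Proof.
move=> rw rs0 rj viol [xs [psi [pp [uxs _ def]]]].
pose e x := nth (nseq m d0) rows (index x xs).
have se x : size (e x) = m.
  case: (ltnP (index x xs) (size rows)) => [xr|rx].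
    by apply/eqP; move/(all_nthP (nseq m d0)): rw; apply.
  by rewrite /e nth_default // size_nseq.
have mape (B : Type) (f : seq D -> B) : map (fun x => f (e x)) xs = map f rows.
  transitivity (map f (map e xs)); first by rewrite -map_comp.
  congr map; apply: (@eq_from_nth _ (nseq m d0)); rewrite size_map size_tuple //.
  by move=> i ix; rewrite (nth_map 0) ?size_tuple // /e index_uniq ?size_tuple.
have [|j jm|F Fm hF] := pp_transfer (m := m) (e := e) pp.
- exact: se.
- apply/def/(qf_relE _ _ _ wf_r0).
  by rewrite /= (mape _ (fun z => nth d0 z j)); exact: rj.
have [h hp nh] := viol F Fm; apply: nh.
have /def/(qf_relE _ _ _ wf_r0) := hF h hp.
by rewrite /= (mape _ h).
Qed.

(** If no suitable function exists on [F], then [r0] is defined by the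
    following formula: there are values for all points of [F] and all rows that
    satisfy every atom true in all coordinates, and the free variables are the
    values of the rows. The coordinates of the rows satisfy it, because
    projections are such values; by the covering hypothesis so does all of
    [r0]. A tuple that satisfies it is the image of the rows under a partial
    polymorphism. *)
Lemma not_pp_violates m (rows : seq (seq D)) :
  width m rows -> size rows = size (qf_vars r0) ->
  (forall t, size t = size (qf_vars r0) -> holds r0 t ->
     exists (j : nat) (g : D -> D), [/\ j < m, map g (coord d0 j rows) = t
       & forall (i : 'I_(size rs)) us, size us = size (qf_vars (rel i)) ->
           holds (rel i) us -> holds (rel i) (map g us)]) ->
  ~ pp_expressible Gamma r0 rs -> violates m rows.
Proof.
move=> rw sr cover nopp F Fw.
case: (pselect (exists2 h, preserves m F h & ~ holds r0 (map h rows))) => // no.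
case: nopp; set k := size (qf_vars r0) in sr cover *.
pose G := nseq m d0 :: rows ++ F; have [n sG] : exists n, n =
  size G by exists (size G).
have Gw : width m G by rewrite /= size_nseq eqxx /= width_cat rw.
have rowG i : i < k -> nth (nseq m d0) rows i \in G.
  by move=> ik; rewrite inE mem_cat mem_nth ?orbT // sr.
pose var z := k + index z G.
have var_lt z : z \in G -> var z < k + n by rewrite ltn_add2l sG index_mem.
pose eqs : seq (formula (defs_sig rs)) :=
  [seq fEq i (var (nth (nseq m d0) rows i)) | i <- iota 0 k].
pose good (i : defs_sig rs) (t : (arity i).-tuple (seq_sub G)) :=
  `[< forall j, j < m -> holds (rel i) (coord d0 j (map val t)) >].
pose rel_atom (i : defs_sig rs) (t : (arity i).-tuple (seq_sub G)) :=
  fRel (map_tuple (fun z => var (val z)) t).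
pose atoms (i : defs_sig rs) :=
  conj_all k [seq rel_atom i t | t <- enum {: (arity i).-tuple (seq_sub G)} &
    good i t].
pose psi := fAnd (conj_all k eqs) (conj_all k [seq atoms i | i <- enum 'I_(size
  rs)]).
exists [tuple of iota 0 k], (exists_vars (iota k n) psi); split.
  apply: pp_exists_vars; rewrite /= !atoms_conj_all // all_map;
    apply/allP => // i _.
  by apply: atoms_conj_all; rewrite all_map; apply/allP.
split; first exact: iota_uniq.
  have kn : k < k + n by rewrite sG -addn1 leq_add2l.
  have : all (fun x => x < k + n) (free_vars psi).
    rewrite /= all_cat !(free_vars_conj_all (P := fun x => x < k + n)) //.
      rewrite all_map; apply/allP => i _ /=; apply: free_vars_conj_all => //.
      rewrite all_map; apply/allP => t _ /=; rewrite all_map; apply/allP => z _ /=.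
      exact: var_lt (valP z).
    rewrite all_map; apply/allP => i; rewrite mem_iota => ik /=.
    by rewrite var_lt ?rowG // (ltn_trans _ kn).
  move=> /allP lt x; rewrite free_vars_exists_vars mem_filter => /andP[+ /lt xkn].
  by rewrite mem_iota xkn andbT -ltnNge => xk;
    rewrite -[_ \in _]/(x \in iota 0 k) mem_iota.
move=> e; rewrite (qf_relE _ _ _ wf_r0) sat_exists_vars /=; split.
  move=> /cover[|j [g [jm gt gh]]]; first by rewrite size_map size_iota.
  exists (fun x => if (k <= x) && (x < k + n)
                   then g (nth d0 (nth [::] G (x - k)) j) else e x).
    by move=> x; rewrite mem_iota => /negPf->.
  have varE z : z \in G -> (if (k <= var z) && (var z < k + n)
      then g (nth d0 (nth [::] G (var z - k)) j) else e (var z)) = g (nth d0 z j).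
    by move=> zG; rewrite leq_addr var_lt // /var addKn nth_index.
  rewrite !sat_conj_all; split=> i; rewrite ?mem_iota ?leq0n ?add0n /= => ik.
    rewrite /= varE ?rowG // leqNgt ik /=.
    have := congr1 (fun s => nth d0 s i) gt.
    rewrite (nth_map d0) ?size_map ?sr // (nth_map (nseq m d0)) ?sr // => ->.
    by rewrite (nth_map 0) ?size_iota // nth_iota.
  rewrite sat_conj_all => t; rewrite mem_filter => /andP[/asboolP tg _] /=.
  apply/defsE.
  have := gh i _ _ (tg j jm); rewrite !size_map size_tuple => /(_ erefl).
  congr (holds _ _); rewrite /coord /= -!map_comp; apply: eq_map => z /=.
  by rewrite varE ?(valP z).
case=> e' ee'; rewrite !sat_conj_all => -[heq hat].
pose h z := e' (var z); apply/notP => nh; apply: no; exists h; last first.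
  suff <- : map e (iota 0 k) = map h rows by [].
  apply: (@eq_from_nth _ d0); rewrite size_map size_iota ?size_map ?sr // => i ik.
  rewrite (nth_map 0) ?size_iota // nth_iota // (nth_map (nseq m d0)) ?sr // /h.
  have := heq i; rewrite mem_iota => /(_ ik) /= <-.
  by rewrite ee' // mem_iota leqNgt ik.
move=> i us usF sus us_col.
have usG : all (mem G) us.
  by apply/allP => z /usF zF; rewrite /= inE mem_cat zF !orbT.
have sz : size us == size (qf_vars (rel i)) by rewrite sus.
have [t et] := lift_tuple (seq_sub G) (v := Tuple sz) usG.
have eus : map val t = us by rewrite -[RHS]/(tval (Tuple sz)) -et.
have := hat i; rewrite mem_enum => /(_ isT); rewrite sat_conj_all => /(_ t).
rewrite mem_filter mem_enum inE andbT => hti.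
have /hti/defsE : good i t by apply/asboolP => j jm; rewrite eus; exact: us_col.
by congr (holds _ _); rewrite /= -map_comp -eus -map_comp.
Qed.

End PrimitivePositive.

(** * Behaviours of canonical functions *)

Lemma build_inj b (X : eqType) (pts : seq X) g g' u :
  build b pts g = build b pts g' -> size u = b -> {subset u <= pts} ->
  g u = g' u.
Proof.
case: u => [|x u] e su up; first by move: e; rewrite -su.
pose w := [seq index y pts | y <- x :: u].
have sw : size w = b by rewrite size_map.
have wp : all (fun i => i < size pts) w.
  by apply/allP => _ /mapP[y /up yp ->]; rewrite index_mem.
have mw : map (nth x pts) w = x :: u.
  by rewrite -map_comp -[RHS]map_id; apply/eq_in_map => y /up yp; exact: nth_index.
by have := congr1 (fun q => lookup q w) e; rewrite !(lookup_build x) // mw.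
Qed.

Lemma pull_build b (X : eqType) (x0 : X) (pts : seq X) g w :
  all (fun i => i < size pts) w ->
  pull (build b pts g) w = build b (map (nth x0 pts) w) g.
Proof.
move=> /allP wp; rewrite /pull build_map; apply: eq_build => u su uw.
by rewrite (lookup_build x0) //; apply/allP => i /uw/wp.
Qed.

(** Provides finite sets with enough points: [S] contains a witness for every
    requirement [P i] that has one. *)
Lemma finite_union (I T : eqType) (l : seq I) (P : I -> seq T -> Prop) :
  exists S : seq T, forall i, i \in l -> (exists s, P i s) ->
    exists2 s : seq T, P i s & {subset s <= S}.
Proof.
elim: l => [|i l [S IH]]; first by exists [::].
case: (pselect (exists s, P i s)) => [[s Ps]|no].
  exists (s ++ S) => j; rewrite inE => /predU1P[->|jl] ex.
    by exists s => // x xs; rewrite mem_cat xs.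
  have [t Pt tS] := IH j jl ex; exists t => // x /tS xS.
  by rewrite mem_cat xS orbT.
exists S => j; rewrite inE => /predU1P[->//|jl] ex; exact: IH.
Qed.

Section Core.
Variables (tau sg : signature) (D : countType) (Delta : structure tau D).
Variables (Gamma : structure sg D) (d0 : D) (b : nat).
Hypothesis b2 : 2 < b.
Hypothesis arity2_le : forall R : tau, (arity R).*2 <= b.
Hypothesis arity_sg : forall R : sg, arity R <= b.
Variables (nb : nat) (F : 'I_nb -> finStructure tau).
Hypothesis bounds : forall A,
  age Delta A <-> forall i, ~ embeds (fin_str (F i)) (fin_str A).
Hypothesis bound_lt : forall i, #|F i| < b.
Hypothesis Delta_hom : homogeneous Delta.
Hypothesis Delta_ordered : ordered (age Delta).
Hypothesis Delta_ramsey : ramsey (age Delta).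
Hypothesis Gamma_red : reduct Gamma Delta.
Variables (r0 : qf_def sg) (rs : seq (qf_def sg)).
Hypothesis wf : all (@wf_qf_def sg) (r0 :: rs).

Let b1 : 1 < b := ltnW b2.
Let b0 : 0 < b := ltnW b1.

Let arity_le (R : tau) : arity R <= b.
Proof. by apply: leq_trans (arity2_le R); rewrite -addnn leq_addr. Qed.

Local Notation typ := (typ Delta d0 b).
Local Notation color := (color Delta d0 b).
Local Notation N := (ncolors tau b).
Local Notation Kb := (local_types Delta d0 b).
Local Notation holds := (qf_holds Gamma d0).
Local Notation rel i := (tnth (in_tuple rs) i).
Local Notation eqS := (eq_colors Delta d0 b).
Local Notation relS := (sg_colors Delta Gamma d0 b).
Local Notation evald := (evald eqS relS).
Local Notation violates := (violates Gamma d0 r0 rs).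
Local Notation preserves := (preserves Gamma d0 rs).
Local Notation coord := (coord d0).

Let evald_typ d xs idx : wf_qf_def d -> 0 < size xs ->
  size (qf_vars d) <= size idx -> all (fun i => i < size xs) idx ->
  evald d (typ xs) idx <-> holds d (map (nth d0 xs) idx).
Proof. exact: evald_holds. Qed.

Lemma evald_iota d xs s : wf_qf_def d -> 0 < s -> size xs = s ->
  size (qf_vars d) <= s -> evald d (typ xs) (iota 0 s) <-> holds d xs.
Proof.
move=> wd s0 sx ds; subst s; rewrite evald_typ ?size_iota //;
  last by apply/allP => i; rewrite mem_iota.
by rewrite map_nth_iota0 // take_size.
Qed.

Lemma holds_iso d g xs : wf_qf_def d -> isomorphism Delta Delta g ->
  size (qf_vars d) <= size xs -> holds d (map g xs) <-> holds d xs.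
Proof.
move=> wd giso; case: (posnP (size xs)) => [/size0nil->//|xs0] dxs.
rewrite -(@evald_iota _ _ (size xs)) ?size_map //.
by rewrite iso_typ // evald_iota.
Qed.

Lemma typ_in xs n : size xs = n -> typ xs \in tabs N b n.
Proof. by move=> <-; exact: typ_tabs. Qed.

Section Behaviour.
Variables (m k : nat).

(** The colour that [beta] prescribes for the images of [us]. *)
Definition beh (beta : seq nat) (rows us : seq (seq D)) : nat :=
  nth 0 beta (index (typ (flatten (rows ++ us))) (tabs N b (k * m + b * m))).

Lemma apply_behE beta rows us I :
  width m (rows ++ us) -> size rows = k ->
  all (fun i => i < size (rows ++ us)) I ->
  apply_beh N beta k m (typ (flatten (rows ++ us))) [seq point m i | i <- I] =
  build b [seq nth [::] (rows ++ us) i | i <- I] (beh beta rows).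
Proof.
move=> zw sr /allP Iz; rewrite /apply_beh !build_map; apply: eq_build => u su uI.
congr (nth 0 beta (index _ _)).
have sfr : size (flatten rows) = k * m.
  move: zw; rewrite width_cat => /andP[rw _].
  by rewrite (size_flatten_width rw) sr.
have uz i : i \in u -> i < size (rows ++ us) by move/uI/Iz.
rewrite pull_typ //; last first.
  rewrite all_cat; apply/andP; split.
    apply/allP => i; rewrite mem_iota flatten_cat size_cat sfr => /andP[_ ik].
    exact: leq_trans ik (leq_addr _ _).
  by apply/allP => x /flattenP[_ /mapP[i /uz iz ->]];
    apply: (allP (point_lt zw iz)).
rewrite map_cat flatten_cat -{1}sfr map_nth_iota0 ?flatten_cat ?size_cat
  ?leq_addr //.
rewrite take_size_cat // -flatten_cat map_flatten; congr (typ (_ ++ flatten _)).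
by rewrite -map_comp; apply/eq_in_map => i /uz iz /=; rewrite map_point.
Qed.

Implicit Types (rows us : seq (seq D)).
Hypothesis k0 : 0 < k.
Hypothesis r0k : size (qf_vars r0) <= k.
Variable s : nat.
Hypothesis bs : b <= s.
Hypothesis rs_s : forall i : 'I_(size rs), size (qf_vars (rel i)) <= s.

Let s0 : 0 < s := leq_trans b0 bs.

Lemma size_flatten_rows rows us : width m (rows ++ us) -> size rows = k ->
  size (flatten (rows ++ us)) = (k + size us) * m.
Proof. by move=> zw <-; rewrite (size_flatten_width zw) size_cat. Qed.

Lemma pull_rows rows us : width m (rows ++ us) -> size rows = k ->
  pull (typ (flatten (rows ++ us))) (iota 0 (k * m)) = typ (flatten rows).
Proof.
move=> zw sr; have rw : width m rows by move: zw; rewrite width_cat => /andP[].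
rewrite pull_typ //; last first.
  apply/allP => i; rewrite mem_iota size_flatten_rows // => /andP[_ /leq_trans].
  by apply; rewrite leq_mul2r leq_addr orbT.
rewrite flatten_cat -sr -(size_flatten_width rw) map_nth_iota0 ?size_cat
  ?leq_addr //.
by rewrite take_size_cat.
Qed.

Lemma eval_column d rows us j l n : wf_qf_def d -> width m (rows ++ us) ->
  j < m -> l + n <= size (rows ++ us) -> 0 < n -> size (qf_vars d) <= n ->
  evald d (typ (flatten (rows ++ us))) (column m j l n) <->
  holds d (coord j (take n (drop l (rows ++ us)))).
Proof.
move=> wd zw jm ln n0 dn; rewrite evald_typ ?(map_column d0) //.
- rewrite (size_flatten_width zw) muln_gt0 (leq_ltn_trans _ jm) // andbT.
  by apply: leq_trans ln; rewrite addn_gt0 n0 orbT.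
- by rewrite size_map size_iota.
- exact: column_lt.
Qed.

(** A behaviour yields a map on each finite set [G] of points: its colours on
    [G] form a table that is realizable by [beh_ok], and a list of points of
    this type contains the values of the map. *)
Lemma nondef_violates : nondef_with N Kb eqS relS r0 rs k m s ->
  exists rows, [/\ width m rows, size rows = k,
    forall j, j < m -> holds r0 (coord j rows) & violates m rows].
Proof.
case/hasP => p0 p0t /and3P[p0r /allP p0col /hasP[beta betaP /andP[bviol /allP
  bok]]].
have [cs scs tcs] := realizableP b1 arity_le bounds bound_lt arity2_le b2 p0t p0r.
have [] := rows_ofP scs; set rows := rows_of m k cs => rw sr fr.
have rw0 : width m (rows ++ [::]) by rewrite cats0.
have p0E : p0 = typ (flatten (rows ++ [::])) by rewrite cats0 fr.
exists rows; split=> // [j jm|G0 G0w].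
  have := p0col j; rewrite mem_iota => /(_ jm);
    rewrite p0E eval_column ?(wf_r0 wf) //.
    by rewrite drop0 cats0 -sr take_size.
  by rewrite cats0 sr.
pose B := beh beta rows.
have Blt us : size us = b -> width m us -> B us < N.
  move=> sus usw; rewrite mem_lists in betaP.
  case/andP: betaP => /eqP sbeta /allP betaN.
  suff /betaN : B us \in beta by rewrite /= mem_iota.
  rewrite mem_nth // sbeta index_mem; apply: typ_in.
  by rewrite size_flatten_rows ?width_cat ?rw // sus mulnDl.
have ok us : size us = s -> width m us ->
    realizable Kb s (build b us B) /\
    forall i, (forall j, j < m -> holds (rel i) (coord j us)) ->
      evald (rel i) (build b us B) (iota 0 s).
  move=> sus usw; have zw : width m (rows ++ us) by rewrite width_cat rw.
  have sz : size (rows ++ us) = k + s by rewrite size_cat sr sus.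
  have sfz : size (flatten (rows ++ us)) = (k + s) * m by rewrite
    size_flatten_rows ?sus.
  have := bok _ (typ_in sfz); rewrite /beh_ok -{1}sfz realizable_typ //=.
  rewrite pull_rows // p0E cats0 eqxx /= apply_behE //; last first.
    by apply/allP => i; rewrite mem_iota sz => /andP[].
  rewrite map_nth_iota ?sz ?addKn // drop_size_cat // -sus take_size sus.
  case/andP=> rB /(all_tnthP (t := in_tuple rs)) pB; split=> // i icol.
  move: (pB i) => /implyP; apply; apply/allP => j; rewrite mem_iota => jm.
  apply/eval_column; rewrite ?(wf_rs wf) ?sz //.
  by rewrite drop_size_cat // -sus take_size; exact: icol.
pose dummy := nseq m d0.
have dummy_w n : width m (nseq n dummy) by rewrite /width all_nseq size_nseq
  eqxx orbT.
have okB us : size us = b -> width m us -> build b us B \in Kb.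
  move=> sus usw; pose us' := us ++ nseq (s - b) dummy.
  have sus' : size us' = s by rewrite size_cat size_nseq sus subnKC.
  have [|/allP rB _] := ok us' sus'; first by rewrite width_cat usw dummy_w.
  have := rB (iota 0 b); rewrite (pull_build _ dummy); last first.
    by apply/allP => i; rewrite mem_iota sus' => /andP[_ /leq_trans]; apply.
  rewrite map_nth_iota0 ?sus' // take_size_cat //; apply.
  rewrite mem_lists size_iota eqxx; apply/allP => i;
    rewrite /= !mem_iota /= !add0n => ib.
  exact: leq_trans ib bs.
(* [dummy] fills up lists of fewer than [s] points. *)
pose G := dummy :: rows ++ G0.
have Gw : width m G by rewrite /= size_nseq eqxx /= width_cat rw.
have Gsub us : {subset us <= G} -> width m us by move=> uG; exact: width_sub uG Gw.
have [hs shs ths] : exists2 hs, size hs = size G & typ hs = build b G B.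
  apply: (realizableP b1 arity_le bounds bound_lt arity2_le b2).
    by apply: build_tabs => us sus /Gsub; exact: Blt.
  apply/allP => w; rewrite mem_lists => /andP[/eqP sw /allP wG].
  have {}wG : all (fun i => i < size G) w.
    by apply/allP => i /wG iG; have : i \in iota 0 (size G) := iG; rewrite mem_iota.
  rewrite (pull_build _ dummy) //; apply: okB; first by rewrite size_map.
  by apply: Gsub => _ /mapP[i iw ->]; rewrite mem_nth // (allP wG).
pose h z := nth d0 hs (index z G).
have hE us : {subset us <= G} -> typ (map h us) = build b us B.
  move=> usG; rewrite /typ build_map; apply: eq_build => u su uus.
  pose w := [seq index z G | z <- u].
  have wG : all (fun i => i < size G) w.
    by apply/allP => _ /mapP[z /uus/usG zG ->]; rewrite index_mem.
  have sw : size w = b by rewrite size_map.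
  have := congr1 (fun q => lookup q w) ths; rewrite lookup_typ ?shs //.
  rewrite (lookup_build dummy) // -!map_comp (_ : map _ u = map h u) // => ->.
  congr B; rewrite -[RHS]map_id; apply/eq_in_map => z /uus/usG zG.
  exact: nth_index.
exists h => [i us usG sus us_col|].
  pose us' := us ++ nseq (s - size us) dummy.
  have sus' : size us' = s by rewrite size_cat size_nseq subnKC // sus rs_s.
  have us'G : {subset us' <= G}.
    move=> z; rewrite mem_cat => /orP[/usG zG|/nseqP[-> _]]; last exact: mem_head.
    by rewrite inE mem_cat zG !orbT.
  have [|_ /(_ i)] := ok us' sus'; first exact: Gsub.
  rewrite -(hE _ us'G) evald_iota ?size_map ?(wf_rs wf) //.
  rewrite map_cat qf_holds_take ?(wf_rs wf) ?size_map ?sus //; apply=> j jm.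
  rewrite /coord map_cat qf_holds_take ?(wf_rs wf) ?size_map ?sus //.
  exact: us_col.
have rowsG : {subset rows <= G} by move=> z zr; rewrite inE mem_cat zr orbT.
move: bviol; rewrite p0E apply_behE //; last first.
  by apply/allP => i; rewrite mem_iota cats0 sr.
rewrite cats0 -{1}sr map_nth_iota0 // take_size => /negP; apply: contra_not.
by rewrite -(hE _ rowsG) evald_iota ?size_map ?(wf_r0 wf).
Qed.

(** This is where the Ramsey property produces a canonical map. Let [X] be a
    finite set that contains the entries [cs] of the rows and realizes every
    type of [s] points of [D^m] over them. For each copy [cs'] of [cs] pick a
    map [f cs'] that violates [r0] at [cs'], and colour a copy [Y] of [X] by
    the table of all values of [f] for the part of [Y] that corresponds to
    [cs]. Let [e] move [H], which contains [X], to a set where all copies of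
    [X] have the same colour. If [us] and [us'] are tuples from [X] of the same
    type over [cs], take an automorphism [g] that fixes [cs] and maps [us'] to
    [us], with [g X] inside [H]. Then [e X] and [e (g X)] are copies with the
    same copy of [cs] and the same colour. The values at the places of [us'] in
    these copies are those at [e us'] and at [e us], so they have the same
    colour. *)
Lemma violates_nondef rows : width m rows -> size rows = k ->
  (forall j, j < m -> holds r0 (coord j rows)) -> violates m rows ->
  nondef_with N Kb eqS relS r0 rs k m s.
Proof.
move=> rw sr rcol viol; pose cs := flatten rows.
have scs : size cs = k * m by rewrite (size_flatten_width rw) sr.
have rows_cs : rows_of m k cs = rows.
  have [cw sc fc] := rows_ofP scs.
  by apply: (flatten_width_inj cw rw); rewrite ?sc.
have ex_f (S cs' : seq D) : exists f : seq D -> D, typ cs' = typ cs ->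
    ~ holds r0 (map f (rows_of m k cs')) /\
    forall (i : 'I_(size rs)) us, width m us -> all (all (mem S)) us ->
      size us = size (qf_vars (rel i)) ->
      (forall j, j < m -> holds (rel i) (coord j us)) ->
      holds (rel i) (map f us).
  case: (pselect (typ cs' = typ cs)) => [e|ne]; last by exists (fun=> d0).
  have [g giso gcs] := typ_iso b1 arity_le Delta_hom e.
  have [|h hp nh] := viol (lists m (map g S)).
    by apply/allP => z; rewrite mem_lists => /andP[].
  have comp us : map (fun z => h (map g z)) us = map h (map (map g) us).
    by rewrite -map_comp.
  exists (fun z => h (map g z)) => _; split.
    by rewrite comp /rows_of map_reshape gcs -/(rows_of m k cs) rows_cs.
  move=> i us usw /allP usS sus ucol; rewrite comp; apply: hp.
  - move=> _ /mapP[z zus ->]; rewrite mem_lists size_map (allP usw) //=.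
    by rewrite all_map; apply/allP => x /(allP (usS z zus)) xS; apply: map_f.
  - by rewrite size_map.
  - move=> j jm; rewrite (coord_map d0 d0 g usw jm).
    by apply/holds_iso; rewrite ?(wf_rs wf) // ?size_map ?sus //; exact: ucol.
have [X1 X1P] := finite_union (tabs N b ((k + s) * m)) (fun q ys =>
  typ (cs ++ ys) = q).
pose X := cs ++ X1; pose n := b * m.
have csX : {subset cs <= X} by move=> x xc; rewrite mem_cat xc.
have [H1 H1P] := finite_union [seq (y, y') | y <- lists n X, y' <- lists n X]
  (fun yy zs => exists2 g, isomorphism Delta Delta g &
     map g (cs ++ yy.1) = cs ++ yy.2 /\ zs = map g X).
pose H := X ++ H1.
pose Pts := lists m (iota 0 (size X)); pose behs := tabs N b (size Pts).
have [S SP] := ramsey_lists d0 b1 arity_le Delta_hom Delta_ordered Delta_ramsey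
  H X (ltn0Sn (size behs)).
have [f fP] := choice (ex_f S).
pose behav Y := build b Pts (fun ws =>
  color (map (fun w => f (take (k * m) Y) (map (nth d0 Y) w)) ws)).
pose col Y : 'I_(size behs).+1 := inord (index (behav Y) behs).
have col_inj Y Y' : col Y = col Y' -> behav Y = behav Y'.
  have behs_in Z : behav Z \in behs by apply: build_tabs => *; exact: color_lt.
  move/(congr1 val); rewrite /= !inordK ?ltnS ?index_size // => ei.
  by rewrite -(nth_index (tab0 b) (behs_in Y)) ei nth_index.
have [H' [tH' H'S [c cP]]] := SP col.
have [e eiso eH] := typ_iso b1 arity_le Delta_hom (esym tH').
have eS x : x \in X -> e x \in S.
  by move=> xX; apply: H'S; rewrite -eH map_f // mem_cat xX.
have te : typ (map e cs) = typ cs by exact: iso_typ.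
pose phi z := f (map e cs) (map e z).
have canonical us us' : size us = b -> size us' = b -> width m us ->
    width m us' -> all (all (mem X)) us -> all (all (mem X)) us' ->
    typ (flatten (rows ++ us)) = typ (flatten (rows ++ us')) ->
    color (map phi us) = color (map phi us').
  move=> su su' uw uw' /allP uX /allP uX'; rewrite !flatten_cat => eu.
  have in_lists vs : size vs = b -> width m vs -> {in vs, forall z,
    all (mem X) z} ->
      flatten vs \in lists n X.
    move=> sv vw vX; rewrite mem_lists (size_flatten_width vw) sv eqxx.
    by apply/allP => x /flattenP[z /vX /allP zX] /zX.
  have [||_ [g giso [gE ->]] gH] := H1P (flatten us', flatten us).
  - by apply/allpairsP; exists (flatten us', flatten us); split; rewrite ?in_lists.
  - have [g giso gE] := typ_iso b1 arity_le Delta_hom (esym eu).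
    by exists (map g X), g.
  have colE Y : {subset Y <= H} -> typ Y = typ X -> col (map e Y) = c.
    move=> YH tY; apply: cP; last by rewrite iso_typ.
    by move=> _ /mapP[y /YH yH ->]; rewrite -eH map_f.
  have : col (map e X) = col (map e (map g X)).
    transitivity c; first by apply: colE => // x xX; rewrite mem_cat xX.
    apply/esym/colE; last exact: iso_typ.
    by move=> x /gH xH; rewrite mem_cat xH orbT.
  move/col_inj/build_inj => /(_ (map (map (index^~ X)) us')).
  rewrite size_map => /(_ su').
  have idx (h : D -> D) z : all (mem X) z ->
      map (nth d0 (map h X)) (map (index^~ X) z) = map h z.
    move=> /allP zX; rewrite -map_comp; apply/eq_in_map => x /zX xX /=.
    by rewrite (nth_map d0) ?index_mem // nth_index.
  move: gE; rewrite map_cat => /eqP; rewrite eqseq_cat ?size_map // =>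
    /andP[/eqP gcs /eqP gus].
  have {}gus : map (map g) us' = us.
    apply: (@flatten_width_inj _ m); rewrite ?width_map ?size_map ?su //.
    by rewrite -map_flatten.
  have takeE (h : D -> D) : take (k * m) (map h X) = map h cs.
    by rewrite -map_take take_size_cat.
  rewrite -[map e (map g X)]map_comp !takeE [map (e \o g) cs]map_comp gcs.
  have sub : {subset [seq map (index^~ X) z | z <- us'] <= Pts}.
    move=> _ /mapP[z zus ->]; rewrite mem_lists size_map (allP uw') //=.
    apply/allP => _ /mapP[x xz ->].
    by rewrite inE mem_iota add0n index_mem; exact: (allP (uX' z zus)).
  move=> /(_ sub); rewrite -!map_comp => e01.
  have -> : map phi us = [seq f (map e cs) (map (e \o g) z) | z <- us'].
    by rewrite -gus -map_comp; apply: eq_map => z; rewrite /= /phi -map_comp.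
  have -> : map phi us' = [seq f (map e cs) (map e z) | z <- us'] by [].
  rewrite (_ : [seq f (map e cs) (map e z) | z <- us'] =
    [seq ((fun w => f (map e cs) [seq nth d0 (map e X) i | i <- w]) \o
          map (index^~ X)) i | i <- us']).
    rewrite e01; congr color; apply/eq_in_map => z /uX' zX /=.
    by rewrite idx.
  by apply/eq_in_map => z /uX' zX /=; rewrite idx.
pose inX us := width m us && all (all (mem X)) us.
have inX_sub us vs : {subset vs <= us} -> inX us -> inX vs.
  move=> sub /andP[uw /allP uX]; rewrite /inX (width_sub sub uw).
  by apply/allP => z /sub/uX.
have ex_beta q : exists v, v < N /\ forall us, size us = b -> inX us ->
    typ (flatten (rows ++ us)) = q -> color (map phi us) = v.
  case: (pselect (exists us, [/\ size us = b,
    inX us & typ (flatten (rows ++ us)) = q])).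
    case=> us [su /andP[uw uX] tu]; exists (color (map phi us)); split;
      first exact: color_lt.
    by move=> vs sv /andP[vw vX] tv; apply: canonical => //; rewrite tv.
  move=> no; exists (color [::]); split; first exact: color_lt.
  by move=> us su ux tu; case: no; exists us.
have [Bf BfP] := choice ex_beta.
pose beta := map Bf (tabs N b (k * m + b * m)).
have behE us : size us = b -> inX us -> beh beta rows us = color (map phi us).
  move=> su ux; have /andP[uw _] := ux; have [_ Bu] := BfP (typ (flatten (rows
    ++ us))).
  have tin : typ (flatten (rows ++ us)) \in tabs N b (k * m + b * m).
    by apply: typ_in; rewrite size_flatten_rows ?width_cat ?rw // su mulnDl.
  by rewrite (Bu us) // /beh (nth_map (tab0 b)) ?index_mem // nth_index.
have buildE us : inX us -> build b us (beh beta rows) = typ (map phi us).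
  move=> ux; rewrite /typ build_map; apply: eq_build => vs sv vu.
  exact/behE/(inX_sub us).
have cs_rows : {in rows, forall z, all (mem X) z}.
  move=> z zr; apply/allP => x xz; apply: csX.
  by apply/flattenP; exists z.
have rowsX : inX rows by rewrite /inX rw; apply/allP.
have [f_viol f_pres] : (~ holds r0 (map phi rows)) /\
    forall (i : 'I_(size rs)) us, inX us ->
      size us = size (qf_vars (rel i)) ->
      (forall j, j < m -> holds (rel i) (coord j us)) ->
      holds (rel i) (map phi us).
  have [viol_f pres_f] := fP (map e cs) te; split.
    move: viol_f; rewrite /rows_of -map_reshape -/(rows_of m k cs) rows_cs.
    by rewrite -map_comp.
  move=> i us /andP[uw /allP uX] su ucol.
  have -> : map phi us = map (f (map e cs)) (map (map e) us) by rewrite -map_comp.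
  apply: pres_f; rewrite ?width_map ?size_map //.
    rewrite all_map; apply/allP => z /uX /allP zX /=.
    by rewrite all_map; apply/allP => x /zX; exact: eS.
  move=> j jm; rewrite (coord_map d0 d0 e uw jm).
  by apply/holds_iso; rewrite ?(wf_rs wf) // ?size_map ?su //; exact: ucol.
have rw0 : width m (rows ++ [::]) by rewrite cats0.
have p0E : typ cs = typ (flatten (rows ++ [::])) by rewrite cats0.
apply/hasP; exists (typ cs); first exact: typ_in.
apply/and3P; split.
- by rewrite -scs; exact: realizable_typ.
- apply/allP => j; rewrite mem_iota => jm.
  rewrite p0E; apply/eval_column; rewrite ?(wf_r0 wf) ?cats0 ?sr //.
  by rewrite drop0 -sr take_size; exact: rcol.
apply/hasP; exists beta.
  rewrite mem_lists size_map eqxx; apply/allP => _ /mapP[q _ ->].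
  by rewrite inE mem_iota; have [] := BfP q.
apply/andP; split.
  rewrite p0E apply_behE //; last first.
    by apply/allP => i; rewrite mem_iota cats0 sr.
  rewrite cats0 -{1}sr map_nth_iota0 // take_size buildE //.
  by apply/negP; rewrite evald_iota ?size_map ?(wf_r0 wf).
apply/allP => q qin; rewrite /beh_ok; apply/implyP => /andP[qr /eqP qp0].
have [xs sxs txs] := realizableP b1 arity_le bounds bound_lt arity2_le b2 qin qr.
have kms : k * m <= (k + s) * m by rewrite leq_mul2r leq_addr orbT.
have ttake : typ (take (k * m) xs) = typ cs.
  rewrite -qp0 -txs pull_typ //; last first.
    by apply/allP => i; rewrite mem_iota sxs => /leq_trans; apply.
  by rewrite map_nth_iota0 // sxs.
have [g giso gcs] := typ_iso b1 arity_le Delta_hom ttake.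
have [||ys tys ysX] := X1P q; first exact: qin.
  exists (map g (drop (k * m) xs)).
  by rewrite -gcs -map_cat cat_take_drop iso_typ.
have sys : size ys = s * m.
  apply/eqP; rewrite -(eqn_add2l (k * m)) -mulnDl -scs -size_cat.
  by rewrite (size_typ b1 (etrans tys (esym txs))) sxs.
have [] := rows_ofP sys; set us := rows_of m s ys => uw su fu.
have usX : inX us.
  rewrite /inX uw; apply/allP => z zu; apply/allP => x xz.
  rewrite inE mem_cat ysX ?orbT // -fu.
  by apply/flattenP; exists z.
have zw : width m (rows ++ us) by rewrite width_cat rw.
have sz : size (rows ++ us) = k + s by rewrite size_cat sr su.
have -> : q = typ (flatten (rows ++ us)) by rewrite flatten_cat fu.
rewrite apply_behE //; last first.
  by apply/allP => i; rewrite mem_iota sz => /andP[].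
rewrite map_nth_iota ?sz ?addKn // drop_size_cat //.
have tk : take s us = us by rewrite -su take_size.
have sphi : size (map phi us) = s by rewrite size_map.
rewrite tk buildE // -{1}sphi realizable_typ /=.
apply/(all_tnthP (t := in_tuple rs)) => i; apply/implyP => /allP ucol.
have wi := wf_rs wf i; have si := rs_s i.
rewrite evald_iota ?size_map //.
rewrite -(cat_take_drop (size (qf_vars (rel i))) us) map_cat.
have st : size (take (size (qf_vars (rel i))) us) = size (qf_vars (rel i)).
  by rewrite size_takel // su.
apply/qf_holds_take; rewrite ?size_map ?st //; apply: f_pres => //.
  by apply: inX_sub usX; exact: mem_take.
move=> j jm; have := ucol j; rewrite mem_iota => /(_ jm)/eval_column.
rewrite sz drop_size_cat // tk => /(_ wi zw jm (leqnn _) s0 si).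
rewrite -{1}(cat_take_drop (size (qf_vars (rel i))) us) /coord map_cat.
by move/qf_holds_take; rewrite size_map st; apply.
Qed.

End Behaviour.

Lemma violates_take m rows : size (qf_vars r0) <= size rows ->
  violates m (take (size (qf_vars r0)) rows) <-> violates m rows.
Proof.
move=> nr; set n := size (qf_vars r0).
have eq_r0 h : holds r0 (map h (take n rows)) <-> holds r0 (map h rows).
  rewrite -[in X in _ <-> X](cat_take_drop n rows) map_cat qf_holds_take ?(wf_r0
    wf) //.
  by rewrite size_map size_takel.
by split=> viol G0 G0w; have [h hp nh] := viol G0 G0w; exists h => //; move: nh;
  rewrite eq_r0.
Qed.

Lemma le_sum_sizes (i : 'I_(size rs)) :
  size (qf_vars (rel i)) <= \sum_(d <- rs) size (qf_vars d).
Proof. by rewrite big_tnth (bigD1 i) //= leq_addr. Qed.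

(** The rows have one column for each type of tuples in [r0]; the list [J] of
    these types is the one computed by the decision procedure. *)
Lemma nondefP : nondef N Kb eqS relS rs r0 <-> ~ pp_expressible Gamma r0 rs.
Proof.
rewrite /nondef; set n := size (qf_vars r0); set J := types_of _ _ _ _ _ _.
set s := b + _; have bs : b <= s by exact: leq_addr.
have rs_s i : size (qf_vars (rel i)) <= s.
  exact: leq_trans (le_sum_sizes i) (leq_addl _ _).
have nk : n <= n.+1 by [].
have holds_ncat t x : size t = n -> holds r0 (t ++ x) <-> holds r0 t.
  by move=> st; apply: qf_holds_take; rewrite ?(wf_r0 wf) ?st.
have coord_take j rows : coord j (take n rows) = take n (coord j rows).
  by rewrite /coord map_take.
split=> [|nopp].
  case/(nondef_violates (ltn0Sn n) nk bs rs_s) => rows [rw sr rcol viol].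
  have st : size (take n rows) = n by rewrite size_takel ?sr.
  apply: (violates_not_pp (d0 := d0) wf (m := size J) (rows := take n rows)) => //.
  - by apply: width_sub rw; exact: mem_take.
  - move=> j /rcol; rewrite coord_take -{1}(cat_take_drop n (coord j rows)).
    by rewrite holds_ncat // size_takel // size_map sr.
  - by apply/violates_take; rewrite ?sr.
have wr0 := wf_r0 wf.
have ex_t q : exists t, q \in J -> size t = n.+1 /\ typ t = q.
  case: (boolP (q \in J)) => [|_]; last by exists [::].
  rewrite mem_filter => /andP[/andP[qr _] qt].
  have [t st tt] := realizableP b1 arity_le bounds bound_lt arity2_le b2 qt qr.
  by exists t.
have [T TP] := choice ex_t; set m := size J.
pose rows := [seq [seq nth d0 (T q) i | q <- J] | i <- iota 0 n.+1].
have sr : size rows = n.+1 by rewrite size_map size_iota.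
have rw : width m rows by apply/allP => _ /mapP[i _ ->]; rewrite size_map.
have col j : j < m -> coord j rows = T (nth (tab0 b) J j).
  move=> jm; have [sT _] := TP _ (mem_nth (tab0 b) jm).
  apply: (@eq_from_nth _ d0) => [|i]; rewrite size_map sr ?sT // => il.
  rewrite (nth_map [::]) ?sr // (nth_map 0) ?size_iota // nth_iota //.
  by rewrite (nth_map (tab0 b)).
have rcol j : j < m -> holds r0 (coord j rows).
  move=> jm; rewrite col //; have qJ := mem_nth (tab0 b) jm.
  have [sT tT] := TP _ qJ; move: qJ; rewrite mem_filter => /andP[/andP[_ +] _].
  by rewrite -{1}tT evald_iota.
apply: (violates_nondef (ltn0Sn n) nk bs rs_s rw sr rcol).
apply/violates_take; first by rewrite sr.
apply: (not_pp_violates (d0 := d0) wf _ _ _ nopp).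
- by apply: width_sub rw; exact: mem_take.
- by rewrite size_takel ?sr.
move=> t st ht; pose t' := t ++ [:: d0].
have st' : size t' = n.+1 by rewrite size_cat st addn1.
have tJ : typ t' \in J.
  rewrite mem_filter typ_in // andbT -{1}st' realizable_typ // andTb.
  by rewrite evald_iota // holds_ncat.
have [sT tT] := TP _ tJ.
have [g giso gT] := typ_iso b1 arity_le Delta_hom tT.
have jm : index (typ t') J < m by rewrite index_mem.
exists (index (typ t') J), g; split=> [//||i us su].
  by rewrite coord_take col // nth_index // map_take gT take_size_cat.
by rewrite holds_iso ?(wf_rs wf) ?su.
Qed.

End Core.

(** * Decidability *)

Lemma leq_sum1 (I : finType) (f : I -> nat) i : f i <= \sum_j f j.
Proof. by rewrite (bigD1 i) //= leq_addr. Qed.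

Theorem theorem1 (tau : signature) (D : countType) (Delta : structure tau D)
    (D_infinite : forall s : seq D, exists x : D, x \notin s)
    (Delta_ordered : ordered (age Delta))
    (Delta_homogeneous : homogeneous Delta)
    (Delta_ramsey : ramsey (age Delta))
    (Delta_finitely_bounded : finitely_bounded (age Delta)) :
  forall (sigma : signature) (Gamma : structure sigma D),
    reduct Gamma Delta -> Expr_pp_decidable Gamma.
Proof.
move=> sg Gamma red; have [d0 _] := D_infinite [::].
have [nb [F bounds]] := Delta_finitely_bounded.
(* Transitivity of forced equality involves 3 points at a time, and its
   compatibility with a relation involves twice the arity; see [eqv_class] and
   [relq_rep]. *)
pose b := 3 + \sum_(R : tau) (arity R).*2 + \sum_(R : sg) arity R
            + \sum_(i < nb) #|F i|.
have b2 : 2 < b by rewrite /b -!addnA.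
have ar_tau (R : tau) : (arity R).*2 <= b.
  have := leq_sum1 (fun R : tau => (arity R).*2) R.
  by move/leq_trans; apply; rewrite /b -!addnA addnCA leq_addr.
have ar_sg (R : sg) : arity R <= b.
  have := leq_sum1 (fun R : sg => arity R) R.
  by move/leq_trans; apply; rewrite /b addnAC leq_addl.
have bound_lt i : #|F i| < b.
  rewrite /b -2!addnA addSn ltnS; have := leq_sum1 (fun i => #|F i|) i.
  by move/leq_trans; apply; rewrite !addnA leq_addl.
have [p hp] := prog_nondef sg (ncolors tau b) (local_types Delta d0 b)
  (eq_colors Delta d0 b) (sg_colors Delta Gamma d0 b).
exists p => r0 rs wf; eexists; split; first exact: hp.
have nP := nondefP d0 b2 ar_tau ar_sg bounds bound_lt Delta_homogeneous
  Delta_ordered Delta_ramsey red wf.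
split=> [/negP nn|pp]; first by apply/notP => /nP.
by apply/negP => /nP.
Qed.
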